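(* Let $A$ be a non-selfinjective Nakayama algebra with $n\ge 2$ simple modules (up to isomorphism). Then $$\operatorname{fdomdim}(A)\le 2n-2.$$
   Context: Standing assumptions: $K$ is an arbitrary field; algebras are finite-dimensional connected $K$-algebras given by quiver and relations, i.e. of the form $KQ/I$ with $Q$ a finite quiver and $I$ an admissible ideal. Modules are finitely generated right modules. $A$ is selfinjective if the right regular module $A$ is injective. A Nakayama algebra is an algebra such that every indecomposable projective left or right module is uniserial. Dominant dimension of a module $M$: let $0\to M\to I_0\to I_1\to I_2\to\cdots$ be a minimal injective coresolution of $M$. If $I_0$ is not projective, $\operatorname{domdim}(M):=0$; otherwise $\operatorname{domdim}(M):=\sup\{m\mid I_i \text{ is projective for } i=0,1,\dots,m\}+1$ (possibly $\infty$). The finitistic dominant dimension of $A$ is $\operatorname{fdomdim}(A):=\sup\{\operatorname{domdim}(M)\mid M \text{ an } A\text{-module with } \operatorname{domdim}(M)<\infty\}$. *)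

(* Defs.v *)
From HB Require Import structures.
From mathcomp Require Import all_boot all_order all_algebra all_field.
From mathcomp Require Import finmap.
From mathcomp Require Import boolp classical_sets constructive_ereal.

Set Implicit Arguments.
Unset Strict Implicit.
Unset Printing Implicit Defensive.

Import Order.TTheory GRing.Theory Num.Theory.
Local Open Scope classical_set_scope.
Local Open Scope ring_scope.

(* Quivers have at least one vertex, so that their path algebras are nonzero. *)
Record quiver := Quiver {
  vertex : finType;
  arrow : finType;
  source : arrow -> vertex;
  target : arrow -> vertex;
  vertex_inh : (0 < #|vertex|)%N }.

Section Paths.
Variable Q : quiver.
Implicit Types (v : vertex Q) (s : seq (arrow Q)).

Fixpoint walk v s : bool :=
  if s is a :: s' then (source a == v) && walk (target a) s' else true.

Definition walk_end v s : vertex Q := last v [seq target a | a <- s].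

(* A path is its starting vertex together with its (possibly empty) list of
   consecutive arrows; the empty lists give the trivial paths. *)
Record qpath := QPath {
  path_val : vertex Q * seq (arrow Q);
  path_valP : walk path_val.1 path_val.2 }.

HB.instance Definition _ := [isSub for path_val].
HB.instance Definition _ := [Choice of qpath by <:].

Implicit Types p q r : qpath.

Definition path_source p : vertex Q := (path_val p).1.
Definition path_arrows p : seq (arrow Q) := (path_val p).2.
Definition path_target p : vertex Q := walk_end (path_source p) (path_arrows p).
Definition path_length p : nat := size (path_arrows p).

Definition trivial_path v : qpath := @QPath (v, [::]) isT.

Lemma walk_cat v s t : walk v (s ++ t) = walk v s && walk (walk_end v s) t.
Proof. by elim: s v => //= a s IHs v; rewrite IHs andbA. Qed.

Lemma walk_end_cat v s t : walk_end v (s ++ t) = walk_end (walk_end v s) t.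
Proof. by rewrite /walk_end map_cat last_cat. Qed.

Fact path_cat_subproof p q : path_target p = path_source q ->
  walk (path_source p) (path_arrows p ++ path_arrows q).
Proof.
by move=> pq; rewrite walk_cat [walk _ _](path_valP p) [walk_end _ _]pq (path_valP q).
Qed.

(* Arrows are composed from left to right: p q is defined when p ends where q
   starts. *)
Definition path_comp p q : option qpath :=
  if path_target p =P path_source q is ReflectT pq
  then Some (@QPath (_, _) (path_cat_subproof pq)) else None.

Lemma path_compP p q r : path_comp p q = Some r <->
  [/\ path_target p = path_source q, path_source r = path_source p
    & path_arrows r = path_arrows p ++ path_arrows q].
Proof.
rewrite /path_comp; case: eqP => pq; split=> //; last by case.
  by case=> <-.
by case: r => -[v s] vs [_ /= vE sE]; congr Some; apply: val_inj; rewrite /= -vE -sE.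
Qed.

Lemma path_compN p q : path_comp p q = None <-> path_target p <> path_source q.
Proof. by rewrite /path_comp; case: eqP. Qed.

Lemma path_compE p q r : path_comp p q = Some r ->
  (path_source r = path_source p) * (path_target r = path_target q).
Proof.
move=> /path_compP[pq rp rE]; split=> //.
by rewrite /path_target rp rE walk_end_cat [walk_end _ (_ p)]pq.
Qed.

Lemma path_comp1l q : path_comp (trivial_path (path_source q)) q = Some q.
Proof. by apply/path_compP. Qed.

Lemma path_comp1r p : path_comp p (trivial_path (path_target p)) = Some p.
Proof. by apply/path_compP; rewrite cats0. Qed.

Lemma path_compA p q r :
  obind (path_comp p) (path_comp q r) = obind (path_comp^~ r) (path_comp p q).
Proof.
case pq: (path_comp p q) => [u|]; case qr: (path_comp q r) => [w|] //=.
- have [ps pt] := path_compE pq; have [qs qt] := path_compE qr.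
  case/path_compP: (pq) => pq' us uE; case/path_compP: (qr) => qr' ws wE.
  case ur: (path_comp u r) => [x|]; last first.
    by case/path_compN: ur; rewrite pt.
  case/path_compP: ur => _ xs xE.
  by apply/path_compP; rewrite qs xs us xE uE wE catA.
- by apply/esym/path_compN; rewrite (path_compE pq).2; apply/path_compN.
- by apply/path_compN; rewrite (path_compE qr).1; apply/path_compN.
Qed.

End Paths.

Section PathAlgebra.
Variables (K : fieldType) (Q : quiver).

(* The K-vector space with basis the paths of Q: finitely supported families of
   coefficients. *)
Record path_algebra := PathAlgebra {
  path_coefs : {fsfun qpath Q -> K with 0} }.

HB.instance Definition _ := [isNew for path_coefs].
HB.instance Definition _ := [Choice of path_algebra by <:].

Implicit Types (p q r : qpath Q) (x y z : path_algebra).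

Definition coef x p : K := path_coefs x p.
Definition psupp x : {fset qpath Q} := finsupp (path_coefs x).

Definition pa_build (D : {fset qpath Q}) (c : qpath Q -> K) : path_algebra :=
  PathAlgebra [fsfun p in D => c p].

Definition path_elt p : path_algebra := pa_build [fset p]%fset (fun=> 1).

Lemma pa_ext x y : (forall p, coef x p = coef y p) -> x = y.
Proof. by case: x y => [x] [y] xy; congr PathAlgebra; apply/fsfunP. Qed.

Lemma coef_build D c p : coef (pa_build D c) p = if p \in D then c p else 0.
Proof. exact: fsfun_fun. Qed.

Lemma coef_notin x p : p \notin psupp x -> coef x p = 0.
Proof. exact: fsfun_dflt. Qed.

Lemma mem_psupp x p : (p \in psupp x) = (coef x p != 0).
Proof. exact: mem_finsupp. Qed.

Lemma coef_elt p q : coef (path_elt p) q = (q == p)%:R.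
Proof. by rewrite coef_build inE; case: eqP. Qed.

Let add x y := pa_build (psupp x `|` psupp y)%fset (fun p => coef x p + coef y p).
Let opp x := pa_build (psupp x) (fun p => - coef x p).
Let zero := pa_build fset0 (fun=> 0).
Let scale c x := pa_build (psupp x) (fun p => c * coef x p).

Let addE x y p : coef (add x y) p = coef x p + coef y p.
Proof.
rewrite coef_build inE !mem_psupp.
by do 2!case: eqP => [->|] //=; rewrite addr0.
Qed.
Let oppE x p : coef (opp x) p = - coef x p.
Proof. by rewrite coef_build mem_psupp; case: eqP => //= ->; rewrite oppr0. Qed.
Let zeroE p : coef zero p = 0. Proof. by rewrite coef_build. Qed.
Let scaleE c x p : coef (scale c x) p = c * coef x p.
Proof. by rewrite coef_build mem_psupp; case: eqP => //= ->; rewrite mulr0. Qed.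

Fact pa_addA : associative add.
Proof. by move=> x y z; apply: pa_ext => p; rewrite !addE addrA. Qed.
Fact pa_addC : commutative add.
Proof. by move=> x y; apply: pa_ext => p; rewrite !addE addrC. Qed.
Fact pa_add0 : left_id zero add.
Proof. by move=> x; apply: pa_ext => p; rewrite addE zeroE add0r. Qed.
Fact pa_addN : left_inverse zero opp add.
Proof. by move=> x; apply: pa_ext => p; rewrite addE oppE zeroE addNr. Qed.
HB.instance Definition _ := GRing.isZmodule.Build path_algebra
  pa_addA pa_addC pa_add0 pa_addN.

Fact pa_scaleA a b x : scale a (scale b x) = scale (a * b) x.
Proof. by apply: pa_ext => p; rewrite !scaleE mulrA. Qed.
Fact pa_scale1 : left_id 1 scale.
Proof. by move=> x; apply: pa_ext => p; rewrite scaleE mul1r. Qed.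
Fact pa_scaleDr : right_distributive scale +%R.
Proof. by move=> c x y; apply: pa_ext => p; rewrite !(scaleE, addE) mulrDr. Qed.
Fact pa_scaleDl x : {morph scale^~ x : a b / a + b}.
Proof. by move=> a b; apply: pa_ext => p; rewrite !(scaleE, addE) mulrDl. Qed.
HB.instance Definition _ := GRing.Zmodule_isLmodule.Build K path_algebra
  pa_scaleA pa_scale1 pa_scaleDr pa_scaleDl.

Lemma coefD x y p : coef (x + y) p = coef x p + coef y p. Proof. exact: addE. Qed.
Lemma coef0 p : coef 0 p = 0. Proof. exact: zeroE. Qed.
Lemma coefZ c x p : coef (c *: x) p = c * coef x p. Proof. exact: scaleE. Qed.
Lemma coef_sum I (r : seq I) (P : pred I) (F : I -> path_algebra) p :
  coef (\sum_(i <- r | P i) F i) p = \sum_(i <- r | P i) coef (F i) p.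
Proof. exact: (big_morph (coef^~ p) (fun x y => coefD x y p) (coef0 p)). Qed.

Section Extend.
Variables (V : lmodType K) (h : qpath Q -> V).

Definition extend x : V := \sum_(p <- psupp x) coef x p *: h p.

Lemma extendEw (D : {fset qpath Q}) x : (psupp x `<=` D)%fset ->
  extend x = \sum_(p <- D) coef x p *: h p.
Proof.
move=> xD; rewrite /extend (big_fset_incl _ xD) // => p _ /coef_notin ->.
by rewrite scale0r.
Qed.

Lemma extend_is_linear : linear extend.
Proof.
move=> c x y.
pose z := c *: x + y; pose D := (psupp x `|` psupp y `|` psupp z)%fset.
rewrite !(@extendEw D); first 1 last.
- by rewrite /D -fsetUA fsetUCA fsubsetUl.
- by rewrite /D -fsetUA fsubsetUl.
- by rewrite /D fsubsetUr.
rewrite scaler_sumr -big_split /=; apply: eq_bigr => p _.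
by rewrite coefD coefZ scalerDl scalerA.
Qed.
HB.instance Definition _ :=
  GRing.isSemilinear.Build K path_algebra V _ extend
    (GRing.semilinear_linear extend_is_linear).

Lemma extend_elt p : extend (path_elt p) = h p.
Proof.
rewrite (@extendEw [fset p]%fset) ?big_seq_fset1 ?coef_elt ?eqxx ?scale1r //.
by apply/fsubsetP => q; rewrite mem_psupp coef_elt inE; case: (eqVneq p q) => //= _; rewrite eqxx.
Qed.
End Extend.

Lemma path_eltE x : x = \sum_(p <- psupp x) coef x p *: path_elt p.
Proof.
apply: pa_ext => q; rewrite coef_sum; case: (boolP (q \in psupp x)) => qx.
  rewrite (big_fsetD1 q) //= coefZ coef_elt eqxx mulr1 big1_fset ?addr0 // => p.
  by rewrite !inE coefZ coef_elt eq_sym => /andP[/negPf-> _]; rewrite mulr0.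
rewrite coef_notin // big1_fset // => p px _; rewrite coefZ coef_elt.
by case: eqP qx px => [-> /negPf->|]; rewrite ?mulr0.
Qed.

Lemma linear_path_ext (V : lmodType K) (f g : path_algebra -> V) :
  linear f -> linear g ->
  (forall p, f (path_elt p) = g (path_elt p)) -> f =1 g.
Proof.
move=> fL gL fg; pose F : {linear _ -> _} := HB.pack f
  (GRing.isSemilinear.Build _ _ _ _ f (GRing.semilinear_linear fL)).
pose G : {linear _ -> _} := HB.pack g
  (GRing.isSemilinear.Build _ _ _ _ g (GRing.semilinear_linear gL)).
move=> x; rewrite [x]path_eltE [LHS](linear_sum F) [RHS](linear_sum G).
by apply: eq_bigr => p _; rewrite [LHS](linearZZ F) [RHS](linearZZ G) /= fg.
Qed.

Definition path_mul p q : path_algebra :=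
  if path_comp p q is Some r then path_elt r else 0.

Definition pa_mul x y : path_algebra :=
  \sum_(p <- psupp x) \sum_(q <- psupp y) (coef x p * coef y q) *: path_mul p q.

Definition pa_one : path_algebra := \sum_(v : vertex Q) path_elt (trivial_path v).

Lemma pa_mulEl x y : pa_mul x y = extend (fun p => extend (path_mul p) y) x.
Proof.
apply: eq_bigr => p _; rewrite scaler_sumr.
by apply: eq_bigr => q _; rewrite scalerA.
Qed.

Lemma pa_mulEr x y : pa_mul x y = extend (fun q => extend (path_mul^~ q) x) y.
Proof.
rewrite /pa_mul exchange_big; apply: eq_bigr => q _; rewrite scaler_sumr.
by apply: eq_bigr => p _; rewrite scalerA mulrC.
Qed.

Lemma pa_mul_elt p q : pa_mul (path_elt p) (path_elt q) = path_mul p q.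
Proof. by rewrite pa_mulEl !extend_elt. Qed.

Let mulLl y : linear (pa_mul^~ y).
Proof. by move=> c x z; rewrite !pa_mulEl linearP. Qed.
Let mulLr x : linear (pa_mul x).
Proof. by move=> c y z; rewrite !pa_mulEr linearP. Qed.

Let mul0 x : pa_mul 0 x = 0. Proof. by rewrite pa_mulEl linear0. Qed.
Let mulx0 x : pa_mul x 0 = 0. Proof. by rewrite pa_mulEr linear0. Qed.

Let pa_mulA3 p q r : pa_mul (path_elt p) (pa_mul (path_elt q) (path_elt r)) =
  pa_mul (pa_mul (path_elt p) (path_elt q)) (path_elt r).
Proof.
rewrite !pa_mul_elt; have := path_compA p q r.
rewrite /path_mul; case: (path_comp p q) => [u|]; case: (path_comp q r) => [w|] /=;
  rewrite ?mul0 ?mulx0 ?pa_mul_elt /path_mul => // E.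
- by rewrite E.
- by rewrite -E.
- by rewrite E.
Qed.

Let pa_mulA2 p q z : pa_mul (path_elt p) (pa_mul (path_elt q) z) =
  pa_mul (pa_mul (path_elt p) (path_elt q)) z.
Proof.
move: z; apply: linear_path_ext; [|exact: mulLr|exact: pa_mulA3].
by move=> c x z; rewrite !mulLr.
Qed.

Let pa_mulA1 p y z : pa_mul (path_elt p) (pa_mul y z) = pa_mul (pa_mul (path_elt p) y) z.
Proof.
move: y; apply: linear_path_ext => [c x y|c x y|q]; last exact: pa_mulA2.
  by rewrite mulLl mulLr.
by rewrite mulLr mulLl.
Qed.

Fact pa_mulA : associative pa_mul.
Proof.
move=> + y z; apply: linear_path_ext => [|c x x'|p]; last exact: pa_mulA1.
  exact: mulLl.
by rewrite !mulLl.
Qed.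

Fact pa_mul1l : left_id pa_one pa_mul.
Proof.
apply: linear_path_ext => [|//|p]; first exact: mulLr.
rewrite pa_mulEl linear_sum (bigD1 (path_source p)) //= big1 => [|v vp].
  by rewrite addr0 !extend_elt /path_mul path_comp1l.
rewrite !extend_elt /path_mul.
by have /path_compN -> : path_target (trivial_path v) <> path_source p by apply/eqP.
Qed.

Fact pa_mul1r : right_id pa_one pa_mul.
Proof.
apply: linear_path_ext => [|//|p]; first exact: mulLl.
rewrite pa_mulEr linear_sum (bigD1 (path_target p)) //= big1 => [|v vp].
  by rewrite addr0 !extend_elt /path_mul path_comp1r.
rewrite !extend_elt /path_mul.
by have /path_compN -> : path_target p <> path_source (trivial_path v)
  by apply/eqP; rewrite eq_sym.
Qed.

Fact pa_mulDl : left_distributive pa_mul +%R.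
Proof. by move=> x y z; rewrite !pa_mulEl linearD. Qed.

Fact pa_mulDr : right_distributive pa_mul +%R.
Proof. by move=> x y z; rewrite !pa_mulEr linearD. Qed.

Fact pa_one_neq0 : pa_one != 0.
Proof.
have /card_gt0P[v _] := vertex_inh Q.
apply/eqP => /(congr1 (coef^~ (trivial_path v))) /eqP.
rewrite coef0 coef_sum (bigD1 v) //= coef_elt eqxx big1 ?addr0 ?oner_eq0 //.
move=> w wv; rewrite coef_elt; case: eqP => // -[wE].
by rewrite wE eqxx in wv.
Qed.

HB.instance Definition _ := GRing.Zmodule_isNzRing.Build path_algebra
  pa_mulA pa_mul1l pa_mul1r pa_mulDl pa_mulDr pa_one_neq0.

Fact pa_scalerAl c x y : c *: (x * y) = (c *: x) * y.
Proof. by rewrite /GRing.mul /= !pa_mulEl linearZ. Qed.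
HB.instance Definition _ := GRing.Lmodule_isLalgebra.Build K path_algebra pa_scalerAl.

Fact pa_scalerAr c x y : c *: (x * y) = x * (c *: y).
Proof. by rewrite /GRing.mul /= !pa_mulEr linearZ. Qed.
HB.instance Definition _ := GRing.Lalgebra_isAlgebra.Build K path_algebra pa_scalerAr.

End PathAlgebra.

(* The m-th power of the arrow ideal: the span of the paths of length >= m. *)
Definition arrow_ideal_pow (K : fieldType) (Q : quiver) (m : nat) :
    set (path_algebra K Q) :=
  [set x | forall p, coef x p != 0 -> (m <= path_length p)%N].

Definition two_sided_ideal (K : fieldType) (R : algType K) (I : set R) : Prop :=
  [/\ I 0, forall x y, I x -> I y -> I (x + y)
    & forall a b x, I x -> I (a * x * b)].

Definition admissible (K : fieldType) (Q : quiver) (I : set (path_algebra K Q)) :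
    Prop :=
  two_sided_ideal I /\
  exists m, [/\ (2 <= m)%N, arrow_ideal_pow m `<=` I & I `<=` arrow_ideal_pow 2].

(* A is isomorphic to K Q / I for the kernel I of f. *)
Definition bound_quiver_algebra (K : fieldType) (A : falgType K) : Prop :=
  exists (Q : quiver) (f : {lrmorphism path_algebra K Q -> A}),
    (forall a, exists x, f x = a) /\ admissible [set x | f x = 0].

Definition connected_algebra (K : fieldType) (A : falgType K) : Prop :=
  forall e : A, e * e = e -> (forall a, e * a = a * e) -> e = 0 \/ e = 1.

Section Opposite.
Variables (K : fieldType) (A : falgType K).

HB.instance Definition _ := GRing.Lmodule.on A^c.

Fact opp_scalerAl (c : K) (x y : A^c) :
  c *: (@GRing.mul A^c x y) = @GRing.mul A^c (c *: x) y.
Proof. exact: (@scalerAr K A c y x). Qed.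
HB.instance Definition _ := GRing.Lmodule_isLalgebra.Build K A^c opp_scalerAl.

Fact opp_scalerAr (c : K) (x y : A^c) :
  c *: (@GRing.mul A^c x y) = @GRing.mul A^c x (c *: y).
Proof. exact: (@scalerAl K A c y x). Qed.
HB.instance Definition _ := GRing.Lalgebra_isAlgebra.Build K A^c opp_scalerAr.
HB.instance Definition _ := Vector.on A^c.

Definition opposite_algebra : falgType K := A^c.

Lemma opposite_mulE (x y : A) : @GRing.mul opposite_algebra x y = y * x.
Proof. by []. Qed.
End Opposite.

(* Since A is finite-dimensional over K, a right A-module is finitely generated
   if and only if it is finite-dimensional over K. *)
Record rmodule (K : fieldType) (A : falgType K) := RModule {
  rmod_carrier :> vectType K;
  ract : rmod_carrier -> A -> rmod_carrier;
  ract_linearl : forall a, linear (ract^~ a);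
  ract_linearr : forall x, linear (ract x);
  ract1 : forall x, ract x 1 = x;
  ractM : forall x a b, ract x (a * b) = ract (ract x a) b }.

Section Modules.
Variables (K : fieldType) (A : falgType K).
Implicit Types M N P I : rmodule A.

Definition is_rhom M N (f : 'Hom(M, N)) : Prop :=
  forall x a, f (ract x a) = ract (f x) a.

Definition rmod_iso M N : Prop := exists2 f : 'Hom(M, N), is_rhom f & bijective f.

Definition is_submod M (U : {vspace M}) : Prop :=
  forall x a, x \in U -> ract x a \in U.

(* Projectivity and injectivity are in the category of finitely generated
   modules. *)
Definition projective P : Prop :=
  forall (M N : rmodule A) (g : 'Hom(M, N)) (f : 'Hom(P, N)),
    is_rhom g -> is_rhom f -> limg g = fullv ->
    exists2 h : 'Hom(P, M), is_rhom h & (g \o h)%VF = f.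

Definition injective_mod I : Prop :=
  forall (M N : rmodule A) (g : 'Hom(M, N)) (f : 'Hom(M, I)),
    is_rhom g -> is_rhom f -> lker g = 0%VS ->
    exists2 h : 'Hom(N, I), is_rhom h & (h \o g)%VF = f.

Definition simple_mod M : Prop :=
  fullv <> 0%VS :> {vspace M} /\
  forall U : {vspace M}, is_submod U -> U = 0%VS \/ U = fullv.

Definition indecomposable M : Prop :=
  fullv <> 0%VS :> {vspace M} /\
  forall U V : {vspace M}, is_submod U -> is_submod V ->
    (U + V)%VS = fullv -> (U :&: V)%VS = 0%VS -> U = 0%VS \/ V = 0%VS.

Definition uniserial M : Prop :=
  forall U V : {vspace M}, is_submod U -> is_submod V -> (U <= V)%VS \/ (V <= U)%VS.

Definition essential M (U : {vspace M}) : Prop :=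
  forall V : {vspace M}, is_submod V -> V <> 0%VS -> (U :&: V)%VS <> 0%VS.

Definition number_of_simples n : Prop :=
  exists S : 'I_n -> rmodule A,
    [/\ forall i, simple_mod (S i),
        forall i j, rmod_iso (S i) (S j) -> i = j
      & forall M, simple_mod M -> exists i, rmod_iso M (S i)].

Fact regular_linearl (a : A) : linear ( *%R^~ a).
Proof. by move=> c x y; rewrite mulrDl scalerAl. Qed.
Fact regular_linearr (x : A) : linear ( *%R x).
Proof. by move=> c a b; rewrite mulrDr scalerAr. Qed.
Definition regular_mod : rmodule A :=
  @RModule K A A *%R regular_linearl regular_linearr (@mulr1 A) (@mulrA A).

Definition selfinjective : Prop := injective_mod regular_mod.

Record cocomplex M := Cocomplex {
  cores :> nat -> rmodule A;
  coaug : 'Hom(M, cores 0);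
  codiff : forall i, 'Hom(cores i, cores i.+1) }.

(* 0 -> M -> C 0 -> C 1 -> ... is exact with injective terms, and C 0 and C i.+1
   are injective envelopes of M and of the image of C i. *)
Definition min_inj_coresolution M (C : cocomplex M) : Prop :=
  [/\ is_rhom (coaug C) /\ (forall i, is_rhom (codiff C i)),
      [/\ lker (coaug C) = 0%VS, limg (coaug C) = lker (codiff C 0)
        & forall i, limg (codiff C i) = lker (codiff C i.+1)],
      forall i, injective_mod (C i)
    & essential (limg (coaug C)) /\ forall i, essential (limg (codiff C i))].

(* The supremum of m + 1 over the m such that C 0, ..., C m are projective, and 0
   if there is no such m. *)
Definition domdim M : \bar int :=
  supremum 0%E [set (m.+1)%:Z%:E | m in [set m : nat |
    exists2 C : cocomplex M, min_inj_coresolution C &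
      forall i, (i <= m)%N -> projective (C i)]].

Definition fdomdim : \bar int :=
  supremum 0%E [set d | exists2 M, d = domdim M & (domdim M < +oo)%E].

End Modules.

Arguments selfinjective {K} A.
Arguments number_of_simples {K} A n.
Arguments fdomdim {K} A.

(* Left A-modules are right modules over the opposite algebra. *)
Definition nakayama (K : fieldType) (A : falgType K) : Prop :=
  (forall P : rmodule A, projective P -> indecomposable P -> uniserial P) /\
  (forall P : rmodule (opposite_algebra A), projective P -> indecomposable P -> uniserial P).

(* Every nonempty set of natural numbers has a least upper bound in \bar int, so
   the default value of supremum above is only used for empty sets. *)
Lemma nat_ereal_supremums (S : set nat) :
  S !=set0 -> supremums [set k%:Z%:E%E | k in S] !=set0.
Proof.
move=> [k0 k0S]; have [[b Sb]|Sub] := pselect (exists b, ubound S b).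
  have [s [sS s_lub]] := nat_supremums_neq0 (ex_intro _ b Sb).
  exists s%:Z%:E%E; split=> [_ [k kS <-]|y yS].
    by rewrite lee_fin lez_nat; apply: sS.
  case: y yS => [y yS|_|/(_ _ (ex_intro2 _ _ k0 k0S erefl)) //].
  2: by rewrite leey.
  have y_ge0 : 0 <= y.
    by have := yS _ (ex_intro2 _ _ k0 k0S erefl); rewrite lee_fin; apply: le_trans.
  rewrite lee_fin -(gez0_abs y_ge0) lez_nat; apply: s_lub => k kS.
  by have := yS _ (ex_intro2 _ _ k kS erefl); rewrite lee_fin -(gez0_abs y_ge0).
exists +oo%E; split=> [_ [k _ <-]|y yS]; first exact: leey.
case: y yS => [y yS|//|/(_ _ (ex_intro2 _ _ k0 k0S erefl))//].
case: Sub; exists `|y|%N => k kS; rewrite leEnat -lez_nat.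
have := yS _ (ex_intro2 _ _ k kS erefl); rewrite lee_fin => /le_trans; apply.
by rewrite abszE ler_norm.
Qed.

(* Main.v *)
From HB Require Import structures.
Require Import Defs.
From mathcomp Require Import all_boot all_order all_algebra all_field.
From mathcomp Require Import boolp classical_sets constructive_ereal.

(** In a minimal injective coresolution 0 -> M -> I_0 -> I_1 -> ... over a
    Nakayama algebra, the simple socle constituents of I_(k+2) are determined by
    those of I_k through a fixed map F on the vertices of the quiver: F v is the
    predecessor, in the cyclic or linear order of the quiver, of the vertex at
    the top of the injective envelope of the simple module at v.  Indeed, for an
    interval module M = [a, b) whose injective envelope is [a, f a), the second
    cosyzygy is [f a, f b).  This is socle_cosyzygy2, which follows single
    elements through the coresolution of an arbitrary module.

    Moreover an injective module is projective exactly when each vertex v of its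
    socle belongs to the set P of those v whose simple module has a projective
    injective envelope (pi_vertex; see proj_inj_socle and
    socle_pi_projective).

    The rest is a count on the functional graph of F, which has at most n
    vertices (coresolution_projective).  Suppose that I_0, ..., I_(2n-2) are
    projective and that I_k is the first term which is not, so that some q
    outside P lies in the socle of I_k.  Going back two steps at a time, q is
    reached by a chain c, F c, F (F c), ... of vertices of P.  Such a chain has
    no repetition, since a periodic orbit inside P never leaves P.
    If k >= 2n, the chain together with q has n + 1 elements, too many.
    If k = 2n - 1, it has exactly n elements, hence contains every vertex; now
    I_(2n-2) is not zero, so its socle gives a vertex d of the socle of I_0
    whose n first iterates d, F d, ..., F^(n-1) d all lie in P; but d occurs in
    the chain, at most n - 1 steps before q, so q lies in P, a contradiction.
    Thus all terms are projective as soon as the first 2n - 1 are.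

    To reach this from quivers and relations, the Nakayama condition is used in
    the form: no two arrows share a source or a target (source_inj, target_inj).
    Then the sum g of all arrows generates the radical as a left and as a right
    ideal, and A is spanned by the elements e_v g^i: this is the structure
    nakayama_frame, in which all the module theory takes place. *)

Set Implicit Arguments.
Unset Strict Implicit.
Unset Printing Implicit Defensive.

Import Order.TTheory GRing.Theory Num.Theory.
Local Open Scope ring_scope.

(** * Submodules, free modules, projective and injective modules *)

Section Modules.
Variables (K : fieldType) (A : falgType K).
Implicit Types (M N I P F : rmodule A) (a b : A).

Definition act_by M a (x : M) : M := ract x a.

HB.instance Definition _ M a := GRing.isSemilinear.Build K M M _ (act_by a)
  (GRing.semilinear_linear (@ract_linearl K A M a)).
HB.instance Definition _ M (x : M) := GRing.isSemilinear.Build K A M _ (ract x)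
  (GRing.semilinear_linear (ract_linearr x)).

Section Action.
Variable M : rmodule A.
Implicit Types x y : M.

Lemma ract0l a : ract (0 : M) a = 0. Proof. exact: (linear0 (act_by a)). Qed.
Lemma ractDl x y a : ract (x + y) a = ract x a + ract y a.
Proof. exact: (linearD (act_by a)). Qed.
Lemma ractBl x y a : ract (x - y) a = ract x a - ract y a.
Proof. exact: (linearB (act_by a)). Qed.
Lemma ractZl c x a : ract (c *: x) a = c *: ract x a.
Proof. exact: (linearZZ (act_by a)). Qed.
Lemma ract_suml (J : Type) (r : seq J) (Q : pred J) (F : J -> M) a :
  ract (\sum_(j <- r | Q j) F j) a = \sum_(j <- r | Q j) ract (F j) a.
Proof. exact: (linear_sum (act_by a)). Qed.
Lemma ract_nil x a i j : ract x (a ^+ i) = 0 -> (i <= j)%N -> ract x (a ^+ j) = 0.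
Proof. by move=> xi /subnKC <-; rewrite exprD ractM xi ract0l. Qed.

End Action.

Section SubModule.
Variables (M : rmodule A) (U : {vspace M}) (hU : is_submod U).

Definition sub_act (x : subvs_of U) a : subvs_of U := vsproj U (ract (vsval x) a).

Lemma sub_actE x a : vsval (sub_act x a) = ract (vsval x) a.
Proof. by rewrite vsprojK // hU // subvsP. Qed.

Fact sub_act_linearl a : linear (sub_act^~ a).
Proof. by move=> c x y; rewrite /sub_act !linearP /= ractDl ractZl linearP. Qed.
Fact sub_act_linearr x : linear (sub_act x).
Proof. by move=> c a b; rewrite /sub_act !linearP. Qed.
Fact sub_act1 x : sub_act x 1 = x.
Proof. by apply: val_inj; rewrite /= sub_actE ract1. Qed.
Fact sub_actM x a b : sub_act x (a * b) = sub_act (sub_act x a) b.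
Proof. by apply: val_inj; rewrite /= !sub_actE ractM. Qed.

Definition sub_rmod : rmodule A := @RModule K A (subvs_of U) sub_act
  sub_act_linearl sub_act_linearr sub_act1 sub_actM.

Lemma sub_ractE (x : sub_rmod) a : vsval (ract x a) = ract (vsval x) a.
Proof. exact: sub_actE. Qed.

Definition sub_incl : 'Hom(sub_rmod, M) := linfun (vsval : subvs_of U -> M).

Lemma sub_inclE x : sub_incl x = vsval x. Proof. exact: lfunE. Qed.
Lemma sub_incl_hom : is_rhom sub_incl.
Proof. by move=> x a; rewrite !sub_inclE sub_ractE. Qed.
Lemma sub_incl_inj : lker sub_incl = 0%VS.
Proof.
apply/eqP/lker0P => x y; rewrite !sub_inclE; exact: val_inj.
Qed.

End SubModule.

Definition free_act (J : finType) (x : {ffun J -> A}) a : {ffun J -> A} :=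
  [ffun j => x j * a].

Section FreeModule.
Variable J : finType.

Fact free_act_linearl a : linear ((@free_act J)^~ a).
Proof. by move=> c x y; apply/ffunP => j; rewrite !ffunE mulrDl scalerAl. Qed.
Fact free_act_linearr x : linear (@free_act J x).
Proof. by move=> c a b; apply/ffunP => j; rewrite !ffunE mulrDr scalerAr. Qed.
Fact free_act1 (x : {ffun J -> A}) : free_act x 1 = x.
Proof. by apply/ffunP => j; rewrite !ffunE mulr1. Qed.
Fact free_actM (x : {ffun J -> A}) a b : free_act x (a * b) = free_act (free_act x a) b.
Proof. by apply/ffunP => j; rewrite !ffunE mulrA. Qed.

Definition free_rmod : rmodule A := @RModule K A {ffun J -> A} (@free_act J)
  free_act_linearl free_act_linearr free_act1 free_actM.

Definition free_basis (j : J) : free_rmod := [ffun i => (i == j)%:R].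

Lemma free_basisE (x : free_rmod) :
  x = \sum_j ract (free_basis j) ((x : {ffun J -> A}) j).
Proof.
apply/ffunP => i; rewrite sum_ffunE (bigD1 i) //= big1 => [|j ji].
  by rewrite !ffunE eqxx mul1r addr0.
by rewrite !ffunE eq_sym (negPf ji) mul0r.
Qed.

Section FreeLift.
Variables (M : rmodule A) (m : J -> M).

Definition free_lift_fun (x : free_rmod) : M :=
  \sum_j ract (m j) ((x : {ffun J -> A}) j).

Fact free_lift_is_linear : linear free_lift_fun.
Proof.
move=> c x y; rewrite /free_lift_fun scaler_sumr -big_split /=.
by apply: eq_bigr => j _; rewrite !ffunE linearP.
Qed.
HB.instance Definition _ := GRing.isSemilinear.Build K free_rmod M _ free_lift_fun
  (GRing.semilinear_linear free_lift_is_linear).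

Definition free_lift : 'Hom(free_rmod, M) := linfun free_lift_fun.

Lemma free_lift_hom : is_rhom free_lift.
Proof.
move=> x a; rewrite !lfunE /= /free_lift_fun ract_suml.
by apply: eq_bigr => j _; rewrite ffunE ractM.
Qed.

Lemma free_lift_basis j : free_lift (free_basis j) = m j.
Proof.
rewrite lfunE /= /free_lift_fun (bigD1 j) //= big1 => [|i ij].
  by rewrite ffunE eqxx ract1 addr0.
by rewrite ffunE (negPf ij) linear0.
Qed.

Lemma free_liftE x : free_lift x = \sum_j ract (m j) ((x : {ffun J -> A}) j).
Proof. by rewrite lfunE. Qed.

End FreeLift.

Lemma free_projective : projective free_rmod.
Proof.
move=> M N g f gh fh gs; pose m j := (g^-1)%VF (f (free_basis j)).
exists (free_lift m); first exact: free_lift_hom.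
apply/lfunP => x; rewrite lfunE /= free_liftE linear_sum [in RHS](free_basisE x) linear_sum.
apply: eq_bigr => j _.
by rewrite /= gh fh limg_lfunVK // gs memvf.
Qed.

End FreeModule.

Lemma retract_projective P F (i : 'Hom(P, F)) (r : 'Hom(F, P)) :
  is_rhom i -> is_rhom r -> (r \o i)%VF = \1%VF -> projective F -> projective P.
Proof.
move=> ih rh ri pF M N g f gh fh gs.
have [|h hh gE] := pF M N g (f \o r)%VF gh _ gs.
  by move=> x a; rewrite !lfunE /= rh fh.
exists (h \o i)%VF; first by move=> x a; rewrite !lfunE /= ih hh.
by rewrite comp_lfunA gE -comp_lfunA ri comp_lfun1r.
Qed.

Lemma regular_projective : projective (regular_mod A).
Proof.
move=> M N g f gh fh gs; pose m := (g^-1)%VF (f (1 : A)).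
exists (linfun (ract m)).
  by move=> x a; rewrite !lfunE /= ractM.
apply/lfunP => x; rewrite !lfunE /= lfunE /= gh limg_lfunVK ?gs ?memvf //.
by rewrite -fh /= mul1r.
Qed.

(** A projective module is a direct summand of a free module; the coordinate
    functions of the free module do the separation. *)
Lemma projective_separated P (s : P) : projective P -> s != 0 ->
  exists2 h : 'Hom(P, regular_mod A), is_rhom h & h s != 0.
Proof.
move=> pP s0; pose J := 'I_(\dim {:P}).
pose g := free_lift (fun j : J => (vbasis {:P})`_j).
have gh : is_rhom g by exact: free_lift_hom.
have gs : limg g = fullv.
  apply/eqP; rewrite eqEsubv subvf /= -[X in (X <= _)%VS](span_basis (vbasisP _)).
  apply/span_subvP => x /(nthP 0)[k]; rewrite size_tuple => kd <-.
  by rewrite -(free_lift_basis (fun j : J => (vbasis {:P})`_j) (Ordinal kd)) memv_img ?memvf.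
have idh : is_rhom (\1%VF : 'Hom(P, P)) by move=> x a; rewrite !lfunE.
have [h hh hE] := pP _ _ g _ gh idh gs.
have hs0 : h s != 0.
  apply: contraNneq s0 => hs; move/lfunP/(_ s): hE.
  by rewrite !lfunE /= hs linear0 => <-.
have [j hj] : exists j, (h s : {ffun J -> A}) j != 0.
  apply/existsP; apply: contraNT hs0; rewrite negb_exists => /forallP hz.
  by apply/eqP/ffunP => j; rewrite ffunE; have := hz j; rewrite negbK => /eqP.
have lpr : linear (fun x : free_rmod J => (x : {ffun J -> A}) j : A).
  by move=> c x y; rewrite !ffunE.
pose pr : {linear _ -> _} := HB.pack (fun x : free_rmod J => (x : {ffun J -> A}) j : A)
  (GRing.isSemilinear.Build _ _ _ _ _ (GRing.semilinear_linear lpr)).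
exists (linfun pr \o h)%VF; last by rewrite comp_lfunE (lfunE pr).
by move=> x a; rewrite !comp_lfunE !(lfunE pr) /= hh ffunE.
Qed.

(** The separating maps are the coordinates of an embedding into a free module,
    and an embedding of an injective module splits. *)
Lemma injective_separated_projective I : injective_mod I ->
  (exists J : finType, exists2 h : J -> 'Hom(I, regular_mod A),
     forall j, is_rhom (h j) & forall x, (forall j, h j x = 0) -> x = 0) ->
  projective I.
Proof.
move=> iI [J [h hh hsep]].
have lphi : linear (fun x : I => [ffun j => h j x] : free_rmod J).
  by move=> c x y; apply/ffunP => j; rewrite !ffunE linearP.
pose phi : {linear _ -> _} := HB.pack (fun x : I => [ffun j => h j x] : free_rmod J)
  (GRing.isSemilinear.Build _ _ _ _ _ (GRing.semilinear_linear lphi)).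
have phih : is_rhom (linfun phi).
  by move=> x a; rewrite !lfunE; apply/ffunP => j; rewrite !ffunE hh.
have phi0 : lker (linfun phi) = 0%VS.
  apply/eqP; rewrite -subv0; apply/subvP => x; rewrite memv_ker memv0 lfunE.
  move=> /eqP/ffunP x0; apply/eqP/hsep => j; have := x0 j; by rewrite !ffunE.
have idh : is_rhom (\1%VF : 'Hom(I, I)) by move=> x a; rewrite !lfunE.
have [r rh rE] := iI _ _ (linfun phi) _ phih idh phi0.
exact: (retract_projective phih rh rE (@free_projective J)).
Qed.

(** The hypothesis says that b a |-> x a is well defined on the right ideal bA;
    the value at 1 of an extension of this map to A is the required y. *)
Lemma injective_divide I b (x : I) : injective_mod I ->
  (forall a, b * a = 0 -> ract x a = 0) -> exists y : I, ract y b = x.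
Proof.
(* f^-1 is a linear section of the left multiplication f on its image bA. *)
move=> iI bx; pose f := amull b; have fE a : f a = b * a by exact: lfunE.
have subU : is_submod (limg f : {vspace regular_mod A}).
  by move=> y a /memv_imgP[c _ ->]; rewrite fE /= -mulrA -fE memv_img ?memvf.
have fK a : a \in limg f -> b * (f^-1)%VF a = a.
  by move=> /limg_lfunVK; rewrite fE.
pose g : 'Hom(sub_rmod subU, I) := (linfun (ract x) \o (f^-1 \o sub_incl subU))%VF.
have gE (y : sub_rmod subU) a : vsval y = b * a -> g y = ract x a.
  move=> yE; rewrite /g !comp_lfunE (lfunE (ract x)) sub_inclE.
  apply/eqP; rewrite -subr_eq0 -linearB /=; apply/eqP/bx.
  by rewrite mulrBr fK ?subvsP // yE subrr.
have gh : is_rhom g.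
  move=> y a; have yE : vsval y = b * (f^-1)%VF (vsval y) by rewrite fK // subvsP.
  by rewrite (gE _ _ yE) -ractM; apply: gE; rewrite sub_actE //= {1}yE mulrA.
have [h hh hE] := iI _ _ (sub_incl subU) g (@sub_incl_hom _ _ subU) gh (@sub_incl_inj _ _ subU).
exists (h (1 : A)); rewrite -hh /= mul1r.
have bU : b \in limg f by rewrite -[b in b \in _]mulr1 -fE memv_img ?memvf.
have E : sub_incl subU (Subvs bU) = b by rewrite sub_inclE.
rewrite -{1}E; move/lfunP/(_ (Subvs bU)): hE; rewrite lfunE /= => ->.
by rewrite (gE _ 1) ?ract1 ?mulr1.
Qed.

End Modules.

(** * Modules over an algebra spanned by the e_v g^i *)

(** The shape of a Nakayama algebra: [gen] is the sum of the arrows, and [next]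
    and [prev] follow the arrow out of, respectively into, a vertex.  At a vertex
    without such an arrow their value is arbitrary, which is harmless: there the
    two sides of [idem_gen] or of [gen_idem] vanish. *)
Record nakayama_frame (K : fieldType) (A : falgType K) (V : finType) := NakayamaFrame {
  idem : V -> A;
  gen : A;
  next : V -> V;
  prev : V -> V;
  idemM : forall v w, idem v * idem w = if v == w then idem v else 0;
  idem_sum : \sum_v idem v = 1;
  idem_gen : forall v, idem v * gen = idem v * gen * idem (next v);
  gen_idem : forall v, gen * idem v = idem (prev v) * gen * idem v;
  gen_nil : exists m, gen ^+ m = 0;
  idem_span : forall u a, exists m (c : nat -> K),
    idem u * a = \sum_(i < m) c i *: (idem u * gen ^+ i) }.

Section Frame.
Variables (K : fieldType) (A : falgType K) (V : finType) (S : nakayama_frame A V).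
Implicit Types (M N I P : rmodule A) (a b : A) (u v w : V) (i j k l : nat).

Let e := idem S.
Let g := gen S.
Let nx := next S.
Let pv := prev S.

Let ee v : e v * e v = e v.
Proof. by rewrite idemM eqxx. Qed.
Let eeN v w : v != w -> e v * e w = 0.
Proof. by rewrite idemM => /negPf ->. Qed.

Lemma idem_pow u i : e u * g ^+ i = e u * g ^+ i * e (iter i nx u).
Proof.
elim: i => [|i IHi] /=; first by rewrite expr0 mulr1 ee.
rewrite exprSr mulrA IHi -(mulrA _ (e _) g) idem_gen !mulrA.
by rewrite -[RHS]mulrA ee.
Qed.

Lemma pow_idem v i : g ^+ i * e v = e (iter i pv v) * g ^+ i * e v.
Proof.
elim: i => [|i IHi] /=; first by rewrite expr0 mulr1 mul1r ee.
rewrite exprS -!mulrA IHi -!mulrA (mulrA g (e _)) gen_idem -!mulrA.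
by rewrite [in RHS]mulrA ee.
Qed.

Lemma idem_pow_idem u v i : e u * g ^+ i * e v != 0 ->
  u = iter i pv v /\ v = iter i nx u.
Proof.
move=> nz; split; apply/eqP; apply: contraNT nz => ne.
  by rewrite -mulrA pow_idem !mulrA eeN ?mul0r.
by rewrite idem_pow -mulrA eeN ?mulr0 // eq_sym.
Qed.

Section Action.
Variable M : rmodule A.
Implicit Types x y s : M.

Lemma act_idem_sum x : x = \sum_v ract x (e v).
Proof. by rewrite -linear_sum idem_sum /= ract1. Qed.

Lemma act_pow_idem x u i : ract x (e u) = x ->
  ract (ract x (g ^+ i)) (e (iter i nx u)) = ract x (g ^+ i).
Proof. by move=> xu; rewrite -{1}xu -!ractM mulrA -idem_pow ractM xu. Qed.

Lemma act_last_pow x : x != 0 ->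
  exists k, ract x (g ^+ k) != 0 /\ ract x (g ^+ k.+1) = 0.
Proof.
move=> x0; have [m gm] := gen_nil S.
have exP : exists k, ract x (g ^+ k) == 0 by exists m; rewrite gm linear0.
case: (ex_minnP exP) => -[|k]; first by rewrite expr0 ract1 (negPf x0).
move=> /eqP xk xmin; exists k; split=> //.
by apply/negP => /xmin; rewrite ltnn.
Qed.

(** Multiply by the last power of g that does not kill x g^i: the terms after the
    i-th disappear, and c i is cancelled. *)
Lemma act_lowest_term x m (c : nat -> K) i : (i < m)%N -> c i != 0 ->
  (forall j, (j < i)%N -> c j = 0) ->
  \sum_(j < m) c j *: ract x (g ^+ j) = 0 -> ract x (g ^+ i) = 0.
Proof.
move=> im ci cj /(congr1 (@ract _ _ _ ^~ (g ^+ _))) sum0.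
apply/eqP/negPn/negP => /act_last_pow[k [xk xk1]].
move: (sum0 k); rewrite ract0l ract_suml (bigD1 (Ordinal im)) //= big1 ?addr0.
  by rewrite ractZl => /eqP; rewrite scaler_eq0 (negPf ci) (negPf xk).
move=> j; rewrite -val_eqE /= neq_ltn ractZl => /orP[/cj->|ij]; first by rewrite scale0r.
apply/eqP; rewrite scaler_eq0 -ractM -exprD; apply/orP; right; apply/eqP.
by apply: (@ract_nil _ _ _ _ _ (i + k.+1)); rewrite ?exprD ?ractM // addnS -addSn leq_add2r.
Qed.

End Action.

Lemma rhom_of_frame M N (f : 'Hom(M, N)) :
  (forall x v, f (ract x (e v)) = ract (f x) (e v)) ->
  (forall x, f (ract x g) = ract (f x) g) -> is_rhom f.
Proof.
move=> fe fg x a.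
have fgi y i : f (ract y (g ^+ i)) = ract (f y) (g ^+ i).
  elim: i => [|i IHi]; first by rewrite expr0 !ract1.
  by rewrite exprSr !ractM fg IHi.
rewrite -[a]mul1r -(idem_sum S) mulr_suml !linear_sum /=.
apply: eq_bigr => v _; have [m [c ->]] := idem_span S v a.
rewrite !linear_sum; apply: eq_bigr => i _.
by rewrite /= !linearZZ /= !ractM fgi fe.
Qed.

(** Elements generating a simple submodule isomorphic to the simple module at v,
    in which g acts as zero. *)
Definition socle_at M v (s : M) : Prop := [/\ s != 0, ract s g = 0 & ract s (e v) = s].

Definition in_socle M v : Prop := exists s : M, socle_at v s.

Lemma socle_at_pow M v (s : M) i : socle_at v s -> (0 < i)%N -> ract s (g ^+ i) = 0.
Proof. by case=> _ sg _; case: i => // i _; rewrite exprS ractM sg ract0l. Qed.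

(** Every nonzero element has a multiple in the socle: project to some e_u, then
    apply the last power of g that does not kill it. *)
Lemma act_socle M (x : M) : x != 0 ->
  exists a, exists v, socle_at v (ract x a).
Proof.
move=> x0.
have [u xu] : exists u, ract x (e u) != 0.
  apply/existsP; apply: contraNT x0; rewrite negb_exists => /forallP xe.
  rewrite (act_idem_sum x) big1 // => v _; exact/eqP/negPn/xe.
have [k [xk xk1]] := act_last_pow xu.
exists (e u * g ^+ k), (iter k nx u); split; first by rewrite ractM.
  by rewrite -ractM -mulrA -exprSr ractM.
by rewrite -ractM -idem_pow.
Qed.

Lemma socle_at_submod M v (s : M) : socle_at v s -> is_submod (<[s]>%VS).
Proof.
move=> ss x a /vlineP[c ->]; rewrite ractZl memvZ //.
case: (ss) => _ sg sv.
rewrite -sv -ractM; have [m [d ->]] := idem_span S v a.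
rewrite linear_sum memv_suml // => i _; rewrite linearZZ /= memvZ // ractM sv.
have [->|i0] := posnP (i : nat); first by rewrite expr0 ract1 memv_line.
by rewrite (socle_at_pow ss i0) mem0v.
Qed.

Lemma essential_socle M v (s : M) (U : {vspace M}) :
  essential U -> socle_at v s -> s \in U.
Proof.
move=> Uess ss; have [s0 _ _] := ss.
have /eqP : (U :&: <[s]>)%VS <> 0%VS.
  apply: Uess (socle_at_submod ss) _ => /eqP.
  by rewrite -dimv_eq0 dim_vline s0.
rewrite -vpick0; set x := vpick _ => x0; have : x \in (U :&: <[s]>)%VS by exact: memv_pick.
rewrite memv_cap => /andP[xU /vlineP[c xE]].
have c0 : c != 0 by apply: contraNneq x0 => c0; rewrite xE c0 scale0r.
by rewrite -(scalerK c0 s) -xE memvZ.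
Qed.

(** Only powers of g matter when checking that e_w g^j a |-> x a is well defined,
    since a linear relation between the e_w g^(j+i) makes its lowest term vanish,
    and then all the terms after it. *)
Lemma injective_lift_pow I w j (x : I) : injective_mod I ->
  ract x (e (iter j nx w)) = x ->
  (forall i, e w * g ^+ (j + i) = 0 -> ract x (g ^+ i) = 0) ->
  exists y : I, ract y (e w * g ^+ j) = x.
Proof.
set u := iter j nx w => iI xu xi; apply: injective_divide => // a.
have [m [c ca]] := idem_span S u a.
rewrite {1}idem_pow -mulrA -[in ract x a]xu -ractM -/u ca => sum0.
rewrite linear_sum big1 // => i _ /=; rewrite linearZZ /= ractM xu.
have [->|ci] := eqVneq (c i) 0; first by rewrite scale0r.
have exi : exists k, c k != 0 by exists i.
case: (ex_minnP exi) => k ck kmin.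
rewrite xi ?scaler0 //.
have ki : (k <= i)%N by exact: kmin.
have := @act_lowest_term (regular_mod A) (e w * g ^+ j) m c k _ ck.
rewrite exprD mulrA -(subnKC ki) exprD mulrA /= => -> //; first by rewrite mul0r.
- exact: leq_ltn_trans ki _.
- by move=> h hk; apply/eqP/negPn/negP => /kmin; rewrite leqNgt hk.
rewrite -[RHS]sum0 mulr_sumr; apply: eq_bigr => h _.
by rewrite -scalerAr mulrA /u -idem_pow.
Qed.

Lemma exists_pow0 v : exists l, g ^+ l * e v == 0.
Proof. by have [m gm] := gen_nil S; exists m; rewrite gm mul0r. Qed.

(** The length of the uniserial left module A e_v, which is also the length of the
    injective envelope of the simple right module at v. *)
Definition height v : nat := ex_minn (exists_pow0 v).

Lemma heightE v l : g ^+ l * e v != 0 -> g ^+ l.+1 * e v = 0 -> height v = l.+1.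
Proof.
move=> l0 /eqP l1; rewrite /height; case: ex_minnP => h /eqP h0 hmin.
apply/eqP; rewrite eqn_leq hmin //= ltnNge; apply: contra l0 => hl.
by rewrite -(subnK hl) exprD -mulrA h0 mulr0.
Qed.

Lemma height0 v : g ^+ height v * e v = 0.
Proof. by rewrite /height; case: ex_minnP => h /eqP. Qed.

Lemma height_pred v : e v != 0 -> g ^+ (height v).-1 * e v != 0 /\ (0 < height v)%N.
Proof.
rewrite /height; case: ex_minnP => -[|h]; first by rewrite mul1r => /eqP->; rewrite eqxx.
by move=> _ hmin _; split=> //; apply/negP => /hmin; rewrite ltnn.
Qed.

(** The vertex at the top of the injective envelope of the simple module at v:
    this envelope has the basis x g^i with i < height v, where x is concentrated
    at [envelope_top v] and x g^(height v - 1) spans the socle. *)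
Definition envelope_top v : V := iter (height v).-1 pv v.

(** The vertex just above the top of the injective envelope. *)
Definition cosyzygy_shift v : V := iter (height v) pv v.

(** The vertices whose simple module has a projective injective envelope: b is
    the image in A of a generator of that envelope. *)
Definition pi_vertex v : Prop :=
  exists b, [/\ b * e (envelope_top v) = b, b * g ^+ (height v).-1 != 0
              & b * g ^+ height v = 0].

Lemma socle_idem M v (s : M) : socle_at v s -> e v != 0.
Proof. by case=> s0 _ sv; apply: contraNneq s0 => ev; rewrite -sv ev linear0. Qed.

(** An injective module contains the whole injective envelope of each of its
    socle elements. *)
Lemma socle_envelope_top I v (s : I) : injective_mod I -> socle_at v s ->
  exists x : I, ract x (e (envelope_top v)) = x /\ ract x (g ^+ (height v).-1) = s.
Proof.
move=> iI ss; have [s0 sg sv] := ss; have ev := socle_idem ss.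
have [h0 hgt0] := height_pred ev; set u := envelope_top v; set h := (height v).-1 in h0 *.
move: (h0); rewrite pow_idem -/u => h1; have [_ vE] := idem_pow_idem h1.
have [||y yE] := @injective_lift_pow I u h s iI.
- by rewrite -vE.
- move=> [|i]; last by rewrite (socle_at_pow ss).
  rewrite addn0 => z; move: h1; rewrite /u /envelope_top -/h in z *.
  by rewrite z mul0r eqxx.
exists (ract y (e u)); rewrite -!ractM; split=> //; by rewrite ?ee.
Qed.

(** Send to A, by a map that does not kill s, the generator x of the injective
    envelope of s: its image has the properties required of b. *)
Lemma proj_inj_socle I v : injective_mod I -> projective I -> in_socle I v -> pi_vertex v.
Proof.
move=> iI pI [s ss]; have [x [xu xs]] := socle_envelope_top iI ss; have [s0 sg sv] := ss.
have [_ hgt0] := height_pred (socle_idem ss).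
have [f fh fs] := projective_separated pI s0.
exists (f x); split.
- by have := fh x (e (envelope_top v)); rewrite /= xu.
- by have := fh x (g ^+ (height v).-1); rewrite /= xs => <-.
have := fh x (g ^+ (height v)).
by rewrite -{1}(prednK hgt0) exprSr ractM xs sg linear0.
Qed.

(** When v satisfies the condition of [pi_vertex], the right ideal bA is the dual
    of A e_v, so the maps from M to it correspond to the linear forms on M e_v.
    The formula below is the map attached to the linear form lam, written in the
    basis of the b g^j, dual to that of the g^(h-1-j) e_v. *)
Section SocleFunctional.
Variables (M : rmodule A) (v : V) (b : A) (lam : {linear M -> K^o}).
Hypotheses (ev : e v != 0) (bu : b * e (envelope_top v) = b) (bh : b * g ^+ height v = 0).

Let h := height v.

Definition socle_map_fun (y : M) : A :=
  \sum_(i < h) lam (ract y (g ^+ i * e v)) *: (b * g ^+ (h.-1 - i)).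

Fact socle_map_is_linear : linear socle_map_fun.
Proof.
move=> c x y; rewrite /socle_map_fun scaler_sumr -big_split /=.
by apply: eq_bigr => i _; rewrite ractDl ractZl linearP scalerDl scalerA.
Qed.
HB.instance Definition _ := GRing.isSemilinear.Build K M A _ socle_map_fun
  (GRing.semilinear_linear socle_map_is_linear).

Definition socle_map : 'Hom(M, regular_mod A) := linfun (socle_map_fun : M -> A).

Lemma socle_mapE y : socle_map y = socle_map_fun y. Proof. exact: lfunE. Qed.

Lemma socle_map_socle s : socle_at v s -> socle_map s = lam s *: (b * g ^+ h.-1).
Proof.
move=> ss; have [s0 sg sv] := ss; have [_ hgt0] := height_pred ev.
rewrite socle_mapE /socle_map_fun (bigD1 (Ordinal hgt0)) //= subn0 mul1r sv.
rewrite big1 ?addr0 // => i i0.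
rewrite ractM (socle_at_pow ss) ?ract0l ?linear0 ?scale0r //.
by rewrite lt0n; apply: contraNneq i0 => i0; apply/eqP/val_inj.
Qed.

Lemma socle_map_hom : is_rhom socle_map.
Proof.
have [h0 hgt0] := height_pred ev; rewrite -/h in h0 hgt0.
apply: rhom_of_frame => [y t|y]; rewrite !socle_mapE /= /socle_map_fun mulr_suml.
  apply: eq_bigr => i _.
  have ih : (i <= h.-1)%N by rewrite -ltnS prednK.
  have tE : iter (h.-1 - i) nx (envelope_top v) = iter i pv v.
    move: h0; rewrite -{1}(subnK ih) exprD -mulrA pow_idem !mulrA => nz.
    have : g ^+ (h.-1 - i) * e (iter i pv v) != 0.
      by apply: contraNneq nz => ->; rewrite !mul0r.
    rewrite pow_idem -iterD subnK // => /idem_pow_idem[_ ->] //.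
  have bE : b * g ^+ (h.-1 - i) = b * g ^+ (h.-1 - i) * e (iter i pv v).
    by rewrite -bu -(mulrA b) -tE -[RHS]mulrA -idem_pow.
  have gE : g ^+ i * e v = e (iter i pv v) * (g ^+ i * e v).
    by rewrite [LHS]pow_idem mulrA.
  rewrite bE -scalerAl -(mulrA _ (e _) (e t)) -ractM gE (mulrA (e t)) !idemM eq_sym.
  by case: eqP => [->|_]; rewrite -?gE -?bE // mulr0 mul0r !linear0 scale0r.
have hE : h = h.-1.+1 by rewrite prednK.
(* The sums differ by a shift of the index and by two extreme terms, which vanish
   because b g^h = 0 and g^h e_v = 0. *)
rewrite hE big_ord_recr big_ord_recl /= subn0.
rewrite -[in X in _ = X + _]scalerAl -(mulrA b) -exprSr -hE bh.
rewrite scaler0 add0r -ractM mulrA -exprS -hE height0 linear0 linear0 scale0r addr0.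
apply: eq_bigr => i _; rewrite -scalerAl -mulrA -exprSr /bump leq0n add1n -ractM mulrA -exprS.
by rewrite subnSK.
Qed.

End SocleFunctional.

(** The maps [socle_map] for all v in the socle of I and all coordinate forms
    separate the elements of the socle of I, hence those of I. *)
Lemma socle_pi_projective I : injective_mod I ->
  (forall v, in_socle I v -> pi_vertex v) -> projective I.
Proof.
move=> iI piI; apply: (injective_separated_projective iI).
pose J : finType := (V * 'I_(\dim {:I}))%type.
have /choice[h hP] : forall j : J, exists h : 'Hom(I, regular_mod A), is_rhom h /\
    (forall s : I, socle_at j.1 s -> coord (vbasis {:I}) j.2 s != 0 -> h s != 0).
  move=> [v k] /=; have [sv|sv] := pselect (in_socle I v); last first.
    exists 0; split=> [x a|s ss]; first by rewrite !lfunE /= mul0r.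
    by case: sv; exists s.
  have [b [bu b0 bh]] := piI v sv.
  have ev : e v != 0 by case: sv => s; exact: socle_idem.
  exists (socle_map v b (coord (vbasis {:I}) k)); split; first exact: socle_map_hom.
  move=> s ss ks; rewrite socle_map_socle // scaler_eq0 negb_or b0 andbT.
  exact: ks.
exists J, h; first by move=> j; case: (hP j).
move=> x hx; apply/eqP/negPn/negP => /act_socle[a [v ss]].
have [s0 _ _] := ss.
have [k sk] : exists k : 'I_(\dim {:I}), coord (vbasis {:I}) k (ract x a) != 0.
  apply/existsP; apply: contraNT s0; rewrite negb_exists => /forallP sk.
  rewrite (coord_vbasis (memvf (ract x a))) big1 // => k _.
  by have := sk k; rewrite negbK => /eqP ->; rewrite scale0r.
have [hh hn] := hP (v, k); have := hn _ ss sk.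
by rewrite hh hx /= mul0r eqxx.
Qed.

(** Lift a socle element z of I2, at the vertex w, to y in I1.  Then y g is not
    zero and comes from some x in I0, concentrated at the vertex u next to w.
    This x is not a multiple t g: otherwise y - d0 t would be a socle
    element of I1, so y would lie in the image of d0.  Let x g^l be the last
    nonzero x g^i.  By injectivity of I0 the only obstruction to dividing x by
    e_w g is that e_w g^(l+1) = 0; so x g^l is a socle element at a vertex v whose
    injective envelope has length l + 1 and top u. *)
Lemma socle_cosyzygy2 (I0 I1 I2 : rmodule A) (d0 : 'Hom(I0, I1)) (d1 : 'Hom(I1, I2)) w :
  is_rhom d0 -> is_rhom d1 -> injective_mod I0 -> limg d0 = lker d1 ->
  essential (limg d0) -> essential (limg d1) -> in_socle I2 w ->
  exists2 v, in_socle I0 v & w = cosyzygy_shift v.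
Proof.
move=> d0h d1h iI0 ex ess0 ess1 [z zs]; have [z0 zg zw] := zs.
have /memv_imgP[y' _ zE] := essential_socle ess1 zs.
pose y := ract y' (e w); have dy : d1 y = z by rewrite d1h -zE.
have yw : ract y (e w) = y by rewrite -ractM ee.
have notim t : d0 t != y.
  apply: contraNneq z0 => ty; rewrite -dy -ty -memv_ker -ex memv_img ?memvf //.
have notsoc t : t \in limg d0 -> ract t (e w) = t -> ract (y - t) g != 0.
  move=> /memv_imgP[t' _ tE] tw; apply/negP => /eqP yt.
  have : y - t \in limg d0.
    have [->|yt0] := eqVneq (y - t) 0; first exact: mem0v.
    by apply: (essential_socle (v := w) ess0); split=> //; rewrite ractBl yw tw.
  move=> /memv_imgP[r _ rE]; have := notim (t' + r).
  by rewrite linearD /= -tE -rE addrC subrK eqxx.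
have yg0 : ract y g != 0 by have := notsoc 0 (mem0v _) (ract0l _ _); rewrite subr0.
have yg : ract y g \in limg d0 by rewrite ex memv_ker d1h dy zg.
set u := nx w.
have egu : e w * g = e w * g * e u by exact: idem_gen.
have yew : ract y g = ract y (e w * g) by rewrite ractM yw.
have wu : w = pv u.
  have := @idem_pow_idem w u 1; rewrite expr1 => -[] //.
  by rewrite -egu; apply: contraNneq yg0; rewrite yew => ->; rewrite linear0.
have /memv_imgP[x' _ xE] := yg.
pose x := ract x' (e u).
have dx : d0 x = ract y g by rewrite d0h -xE yew -ractM -egu.
have xu : ract x (e u) = x by rewrite -ractM ee.
have nlift : ~ exists t, ract t (e w * g) = x.
  move=> [t tx].
  have := notsoc (d0 (ract t (e w))); rewrite memv_img ?memvf //.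
  rewrite -d0h -ractM ee ractBl -d0h -ractM tx dx subrr eqxx.
  by move=> /(_ isT erefl).
have x0 : x != 0 by apply: contraNneq yg0; rewrite -dx => ->; rewrite linear0.
have [l [xl xl1]] := act_last_pow x0.
have wl : e w * g ^+ l.+1 = 0.
  apply: contrapT => wl; apply: nlift.
  have := @injective_lift_pow I0 w 1 x iI0; rewrite expr1; apply=> // i.
  rewrite add1n => wi; apply: (ract_nil xl1); rewrite ltnNge; apply/negP => il.
  by apply: wl; rewrite -(subnKC il) -addSn exprD mulrA wi mul0r.
pose v := iter l nx u; exists v.
  exists (ract x (g ^+ l)); split=> //; first by rewrite -ractM -exprSr.
  exact: act_pow_idem.
have ul : e u * g ^+ l * e v != 0.
  by rewrite -idem_pow; apply: contraNneq xl => ul; rewrite -xu -ractM ul linear0.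
have [uE _] := idem_pow_idem ul.
have gl : g ^+ l * e v = e u * g ^+ l * e v by rewrite [LHS]pow_idem -uE.
rewrite /cosyzygy_shift (@heightE v l) /= -?uE -?wu ?gl //.
have gu : g * e u = e w * g by rewrite gen_idem -/pv -wu -egu.
by rewrite exprS -mulrA gl !mulrA gu -(mulrA (e w)) -exprS wl mul0r.
Qed.

End Frame.

(** * Counting along a coresolution *)

(** A repetition would confine the whole orbit to its first k elements. *)
Lemma orbit_uniq (V : finType) (F : V -> V) (P : V -> Prop) (c : V) k :
  (forall i, (i < k)%N -> P (iter i F c)) -> ~ P (iter k F c) ->
  uniq (traject F c k.+1).
Proof.
move=> Pi nP; rewrite looping_uniq; apply/negP => /loopingP/(_ k)/trajectP[i ik kE].
by apply: nP; rewrite kE; apply: Pi.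
Qed.

Section Coresolution.
Variables (K : fieldType) (A : falgType K) (V : finType) (S : nakayama_frame A V).
Variables (n : nat) (n2 : (2 <= n)%N) (cardV : (#|V| <= n)%N).
Variables (M : rmodule A) (C : cocomplex M) (hC : min_inj_coresolution C).

Let F := cosyzygy_shift S.

Lemma socle_chain i j w : in_socle S (cores C (j + 2 * i)) w ->
  exists2 v, w = iter i F v &
    forall i', (i' <= i)%N -> in_socle S (cores C (j + 2 * i')) (iter i' F v).
Proof.
have [[_ dh] [_ _ ex] iC [_ ess]] := hC; have [[h0 _] [_ ex0 _] _ [ess0 _]] := hC.
elim: i w => [|i IHi] w wE.
  by exists w => // -[|//] _.
have [v' v's wv'] : exists2 v', in_socle S (cores C (j + 2 * i)) v' & w = F v'.
  have jE : (j + 2 * i.+1 = (j + 2 * i).+2)%N by rewrite mulnS addnCA.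
  rewrite jE in wE; apply: (socle_cosyzygy2 _ _ _ _ _ _ wE) => //.
have [v v'E vs] := IHi _ v's.
exists v; first by rewrite iterS -v'E.
move=> i'; rewrite leq_eqVlt => /orP[/eqP->|]; last exact: vs.
by rewrite iterS -v'E -wv'.
Qed.

(** The counting argument explained at the top: k is the first index whose term
    is not projective, and q a vertex of its socle outside P. *)
Lemma coresolution_projective : (forall i, (i <= 2 * n - 2)%N -> projective (cores C i)) ->
  forall k, projective (cores C k).
Proof.
have [_ _ iC [_ ess]] := hC.
move=> pC; elim/ltn_ind => k IHk; have [/pC//|kn] := leqP k (2 * n - 2).
apply: (socle_pi_projective (S := S) (iC k)) => q qs; apply: contrapT => nq.
have pi j v : (j < k)%N -> in_socle S (cores C j) v -> pi_vertex S v.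
  by move=> jk; apply: proj_inj_socle => //; exact: IHk.
have [k2n|k2n] := leqP (2 * n) k.
  have kE : k = (k - 2 * n + 2 * n)%N by rewrite subnK.
  rewrite kE in qs; have [c qE cs] := socle_chain qs.
  have /card_uniqP : uniq (traject F c n.+1).
    apply: (@orbit_uniq _ _ (pi_vertex S)); last by rewrite -qE.
    move=> i i_n; apply: (pi (k - 2 * n + 2 * i)%N); last by apply: cs; exact: ltnW.
    by rewrite [X in (_ < X)%N]kE ltn_add2l ltn_mul2l.
  rewrite size_traject => cE.
  by have := max_card (mem (traject F c n.+1)); rewrite cE leqNgt ltnS cardV.
(* The remaining case is k = 2n - 1, an odd index. *)
have kE : k = (1 + 2 * n.-1)%N.
  apply/eqP; rewrite eqn_leq; move: k2n kn; case: n n2 => // n' _.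
  by rewrite mulnS /= add1n ltnS => -> ; rewrite addnC addnK.
rewrite kE in qs pi; have [c qE cs] := socle_chain qs.
have cP i : (i < n.-1)%N -> pi_vertex S (iter i F c).
  move=> i_n; apply: (pi (1 + 2 * i)%N); last by apply: cs; exact: ltnW.
  by rewrite ltn_add2l ltn_mul2l.
have Uc : uniq (traject F c n).
  by rewrite -(prednK (ltnW n2)); apply: orbit_uniq cP _; rewrite -qE.
have [x x0] : exists x : cores C (0 + 2 * n.-1), x != 0.
  have [s ss] := qs; have [s0 _ _] := ss.
  have /memv_imgP[x _ sE] := essential_socle (ess (2 * n.-1)%N) ss.
  by exists x; apply: contraNneq s0 => x0; rewrite sE x0 linear0.
have [a [v vs]] := act_socle S x0.
have [d vE ds] := socle_chain (ex_intro _ _ vs).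
have : d \in traject F c n.
  have /subset_cardP E : #|traject F c n| = #|V|.
    apply/eqP; rewrite eqn_leq max_card (card_uniqP Uc) size_traject.
    exact: cardV.
  by have := E (subset_predT _) d => ->.
move=> /trajectP[i i_n dE]; apply: nq.
have -> : q = iter (n.-1 - i) F d.
  by rewrite qE dE -iterD subnK // -ltnS (prednK (ltnW n2)).
apply: (pi (0 + 2 * (n.-1 - i))%N); last by apply: ds; exact: leq_subr.
by rewrite add0n add1n ltnS leq_mul2l leq_subr orbT.
Qed.

End Coresolution.

Section DominantDimension.
Variables (K : fieldType) (A : falgType K) (V : finType) (S : nakayama_frame A V).
Variables (n : nat) (n2 : (2 <= n)%N) (cardV : (#|V| <= n)%N).
Local Open Scope classical_set_scope.

Lemma supremum_ub (B : set (\bar int)) (b : \bar int) :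
  (0 <= b)%E -> ubound B b -> (supremum 0%E B <= b)%E.
Proof.
move=> b0 Bb; rewrite /supremum; case: ifP => // _.
by case: xgetP => // y _ [_ yB]; apply: yB.
Qed.

(** If the first 2n - 1 terms of a minimal coresolution of M are projective then
    all of them are, and the set defining domdim M is unbounded. *)
Lemma domdim_bound (M : rmodule A) : (domdim M < +oo)%E ->
  (domdim M <= ((2 * n - 2)%N%:Z)%:E)%E.
Proof.
rewrite /domdim; set D := [set m : nat | _]; set D' := [set _ | _ in D] => fin.
apply: supremum_ub; first by rewrite lee_fin.
move=> _ [m [C hC pC] <-]; rewrite lee_fin lez_nat leqNgt; apply/negP => mn.
have allD k : D k.
  exists C => // i _; apply: (coresolution_projective S n2 cardV hC) => j jn.
  by apply: pC; apply: leq_trans jn _.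
have supD' : supremums D' !=set0.
  have -> : D' = [set k%:Z%:E%E | k in [set m.+1 | m in D]].
    apply/seteqP; split=> [_ [k Dk <-]|_ [_ [k Dk <-] <-]]; last by exists k.
    by exists k.+1 => //; exists k.
  by apply: nat_ereal_supremums; exists 1%N; exists 0%N.
have ub k : (k.+1%:Z%:E <= supremum 0 D')%E.
  by apply: ge_supremum_Nmem => //; exists k.
case: (supremum 0%E D') fin ub => [r|//|] _ ub; last by have := ub 0%N.
have := ub `|r|%N; rewrite lee_fin => /le_trans/(_ (ler_norm r)).
by rewrite -abszE lez_nat ltnn.
Qed.

Lemma fdomdim_bound : (fdomdim A <= ((2 * n - 2)%N%:Z)%:E)%E.
Proof.
apply: supremum_ub; first by rewrite lee_fin.
by move=> _ [M -> fin]; apply: domdim_bound.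
Qed.

End DominantDimension.

(** * Local idempotents and uniserial modules *)

Section Local.
Variables (K : fieldType) (A : falgType K).

(** Compare the submodules generated by x and y. *)
Lemma uniserial_cyclic (M : rmodule A) (x y : M) : uniserial M ->
  (exists c, x = ract y c) \/ (exists c, y = ract x c).
Proof.
pose cyc (z : M) := limg (linfun (ract z)).
have subc z : is_submod (cyc z).
  move=> _ a /memv_imgP[c _ ->]; rewrite lfunE /= -ractM -(lfunE (ract z)).
  by rewrite memv_img ?memvf.
have memc z : z \in cyc z by rewrite -{1}(ract1 z) -(lfunE (ract z)) memv_img ?memvf.
move=> /(_ _ _ (subc x) (subc y))[]/subvP/(_ _ (memc _))/memv_imgP[c _]; rewrite lfunE => cE.
  by left; exists c.
by right; exists c.
Qed.

(** The corner ring e A e is local.  The inverses are two-sided so that the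
    condition passes to the opposite algebra. *)
Definition local_idem (e : A) : Prop :=
  [/\ e * e = e, e != 0 & forall x, e * x = x -> x * e = x -> exists y,
    (x * y = e /\ y * x = e) \/ ((e - x) * y = e /\ y * (e - x) = e)].

(** The right module eA is projective as a summand of A and indecomposable since
    e A e is local, hence uniserial. *)
Lemma local_idem_uniserial (e a b : A) :
  (forall P : rmodule A, projective P -> indecomposable P -> uniserial P) ->
  local_idem e -> e * a = a -> e * b = b ->
  (exists y, a = b * y) \/ (exists y, b = a * y).
Proof.
move=> nak [ee e0 eloc] ea eb; pose U : {vspace regular_mod A} := limg (amull e).
have eU x : (x \in U) = (e * x == x).
  apply/idP/eqP => [/memv_imgP[c _ ->]|<-]; first by rewrite lfunE /= mulrA ee.
  by rewrite -[e * x]/((e \*o idfun) x) -lfunE memv_img ?memvf.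
have subU : is_submod U by move=> x c; rewrite !eU /= mulrA => /eqP ->.
pose P := sub_rmod subU.
pose r : 'Hom(regular_mod A, P) := (linfun (vsproj U) \o amull e)%VF.
have rE x : vsval (r x) = e * x.
  by rewrite /r comp_lfunE (lfunE (vsproj U)) vsprojK ?eU ?lfunE //= mulrA ee.
have eP (x : P) : e * vsval x = vsval x by apply/eqP; rewrite -eU subvsP.
have pP : projective P.
  apply: (retract_projective (i := sub_incl subU) (r := r)); last exact: regular_projective.
  - exact: sub_incl_hom.
  - by move=> x c; apply: subvs_inj; rewrite sub_ractE !rE /= mulrA.
  by apply/lfunP => x; apply: subvs_inj; rewrite comp_lfunE id_lfunE rE sub_inclE eP.
have iP : indecomposable P.
  split.
    move/vspaceP/(_ (r e)); rewrite memvf memv0 => /esym/eqP/(congr1 (@vsval _ _ _)).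
    by rewrite rE ee /=; apply/eqP.
  move=> U1 U2 sU1 sU2 U12 I12.
  have full (U' : {vspace P}) (x : P) y : is_submod U' -> x \in U' ->
      vsval x * e * y = e -> U' = fullv.
    move=> sU' xU' xy; apply/eqP; rewrite eqEsubv subvf /=; apply/subvP => z _.
    have -> : z = ract x (e * y * vsval z).
      by apply: subvs_inj; rewrite (sub_ractE x) /= !mulrA xy eP.
    exact: sU'.
  have : r e \in (U1 + U2)%VS by rewrite U12 memvf.
  move=> /memv_addP[u uU1 [w wU2 /(congr1 (@vsval _ _ _))]].
  rewrite rE ee /= => uwE.
  have wE : e - vsval u * e = vsval w * e by rewrite -{1}ee {1}uwE mulrDl addrAC subrr add0r.
  have [||y [[xy _]|[xy _]]] := eloc (vsval u * e).
  - by rewrite mulrA eP.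
  - by rewrite -mulrA ee.
  - right; have U1f := full U1 u y sU1 uU1 xy.
    by rewrite -I12 U1f capfv.
  - left; rewrite wE in xy; have U2f := full U2 w y sU2 wU2 xy.
    by rewrite -I12 U2f capvf.
have [[c cE]|[c cE]] := uniserial_cyclic (r a) (r b) (nak P pP iP);
  move/(congr1 (@vsval _ _ _)): cE; rewrite (sub_ractE (r _)) !rE ea eb => cE.
  by left; exists c.
by right; exists c.
Qed.

(** Geometric series in the corner ring e A e. *)
Lemma corner_inverse (e x : A) m : e * e = e -> e * x = x -> x * e = x ->
  (e - x) ^+ m = 0 -> exists y, x * y = e /\ y * x = e.
Proof.
move=> ee ex xe; set r := e - x => rm.
pose s := \sum_(i < m) r ^+ i.
have er : e * r = r by rewrite mulrBr ee ex.
have re : r * e = r by rewrite mulrBl ee xe.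
have sr : s * r = r * s.
  by rewrite mulr_suml mulr_sumr; apply: eq_bigr => i _; rewrite -exprS -exprSr.
have s1 : (1 - r) * s = 1.
  by rewrite -[LHS]opprK -mulNr opprB -subrX1 rm sub0r opprK.
have s2 : s * (1 - r) = 1 by rewrite mulrBr mulr1 sr -[X in X - _]mul1r -mulrBl s1.
have xE : x = e - r by rewrite /r subKr.
clearbody s r.
exists (e * s * e); split.
  have -> : x * (e * s * e) = e * ((1 - r) * s) * e.
    by rewrite xE !mulrA mulrBl ee re mulrBr mulr1 er.
  by rewrite s1 mulr1 ee.
have -> : e * s * e * x = e * (s * (1 - r)) * e.
  by rewrite xE -!mulrA mulrBr ee er mulrBl mul1r re.
by rewrite s2 mulr1 ee.
Qed.

End Local.

(** * Coefficients in path algebras *)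

Section PathAlgebra.
Variables (K : fieldType) (Q : quiver).
Implicit Types (p q r : qpath Q) (x y z : path_algebra K Q) (v : vertex Q) (a : arrow Q).

Lemma path_elt_mul p q : path_elt K p * path_elt K q = path_mul K p q.
Proof. exact: pa_mul_elt. Qed.

Lemma coef_mul_neq0 x y r : coef (x * y) r != 0 ->
  exists p q, [/\ coef x p != 0, coef y q != 0 & path_comp p q = Some r].
Proof.
move=> /eqP nz; apply: contrapT => nex; apply: nz.
rewrite -[x * y]/(pa_mul x y) Defs.coef_sum big1 // => p _; rewrite Defs.coef_sum big1 // => q _.
rewrite Defs.coefZ; apply/eqP; rewrite mulf_eq0 mulf_eq0.
apply: contrapT => /negP; rewrite !negb_or => /andP[/andP[px qy]].
rewrite /path_mul; case pq: (path_comp p q) => [r'|]; last by rewrite Defs.coef0 eqxx.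
rewrite coef_elt; have [rE|] := eqVneq r r'; last by rewrite eqxx.
by case: nex; exists p, q; rewrite rE.
Qed.

Lemma pa_coef1 v : coef (1 : path_algebra K Q) (trivial_path v) = 1.
Proof.
rewrite -[1]/(pa_one K Q) Defs.coef_sum (bigD1 v) //= coef_elt eqxx big1 ?addr0 // => w wv.
by rewrite coef_elt; case: eqP => // -[wE]; rewrite wE eqxx in wv.
Qed.

Lemma pa_coefB x y p : coef (x - y) p = coef x p - coef y p.
Proof. by rewrite -scaleN1r Defs.coefD Defs.coefZ mulN1r. Qed.

(** Subtracting a multiple of 1 from x reduces to the case where x has no
    component on the trivial path, which factors only as its own square. *)
Lemma coef_mul_trivial x y v :
  coef (x * y) (trivial_path v) = coef x (trivial_path v) * coef y (trivial_path v).
Proof.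
set c := coef x _.
have -> : x * y = (x - c *: 1) * y + c *: y.
  by rewrite mulrBl -scalerAl mul1r subrK.
rewrite Defs.coefD Defs.coefZ; set t := coef (_ * y) _; suff -> : t = 0 by rewrite add0r.
apply/eqP/negPn/negP => /coef_mul_neq0[p [q [px _ /path_compP[_ ps pa]]]].
have pE : p = trivial_path v.
  apply: val_inj; move: ps pa; rewrite /path_source /path_arrows /=.
  by case: (path_val p) => [w [|b s]] //= -> .
by move: px; rewrite pE pa_coefB Defs.coefZ pa_coef1 mulr1 subrr eqxx.
Qed.

Lemma arrow_ideal_powM x y i j : arrow_ideal_pow i x -> arrow_ideal_pow j y ->
  arrow_ideal_pow (i + j) (x * y).
Proof.
move=> xi yj r /coef_mul_neq0[p [q [/xi pi /yj qj /path_compP[_ _ rE]]]].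
by rewrite /path_length rE size_cat leq_add.
Qed.

Lemma arrow_ideal_powX x m : arrow_ideal_pow 1 x -> arrow_ideal_pow m (x ^+ m).
Proof.
move=> x1; elim: m => [|m IHm]; first by [].
by rewrite exprS -add1n; apply: arrow_ideal_powM.
Qed.

Lemma arrow_ideal_pow1P x :
  (forall v, coef x (trivial_path v) = 0) -> arrow_ideal_pow 1 x.
Proof.
move=> x0 [[v [|a s]] vs] //; have -> : QPath vs = trivial_path v by apply: val_inj.
by rewrite x0 eqxx.
Qed.

Fact arrow_path_subproof a : walk (source a) [:: a].
Proof. by rewrite /= eqxx. Qed.
Definition arrow_path a : qpath Q := @QPath Q (source a, [:: a]) (arrow_path_subproof a).

Lemma trivial_mul v q :
  path_elt K (trivial_path v) * path_elt K q = if v == path_source q then path_elt K q else 0.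
Proof.
rewrite path_elt_mul /path_mul; case: eqP => [->|ne]; first by rewrite path_comp1l.
by have /path_compN -> : path_target (trivial_path v) <> path_source q.
Qed.

Lemma mul_trivial v p :
  path_elt K p * path_elt K (trivial_path v) = if path_target p == v then path_elt K p else 0.
Proof.
rewrite path_elt_mul /path_mul; case: eqP => [<-|ne]; first by rewrite path_comp1r.
by have /path_compN -> : path_target p <> path_source (trivial_path v).
Qed.

Lemma coef_arrow_mull a b y :
  coef (path_elt K (arrow_path b) * y) (arrow_path a) != 0 -> a = b.
Proof.
case/coef_mul_neq0 => p [q [pb _ /path_compP[_ _]]].
move: pb; rewrite coef_elt; case: (eqVneq p) => [-> _ []|_] //.
by rewrite eqxx.
Qed.

Lemma coef_arrow_mulr a b y :
  coef (y * path_elt K (arrow_path b)) (arrow_path a) != 0 -> a = b.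
Proof.
case/coef_mul_neq0 => p [q [_ qb /path_compP[_ _]]].
move: qb; rewrite coef_elt; case: (eqVneq q) => [-> _|_]; last by rewrite eqxx.
by rewrite /path_arrows /= cats1 -[[:: a]]/(rcons [::] a) => /rcons_inj[].
Qed.

End PathAlgebra.

(** * From quivers with relations to vertex idempotents and the arrow sum *)

Lemma local_idem_opposite (K : fieldType) (A : falgType K) (e : A) :
  local_idem e -> local_idem (A := opposite_algebra A) e.
Proof.
move=> [ee e0 el]; split=> // x ex xe.
have [y hy] := el x xe ex; exists y.
by case: hy => -[xy yx]; [left | right].
Qed.

Lemma local_idem_uniserial_left (K : fieldType) (A : falgType K) (e a b : A) :
  (forall P : rmodule (opposite_algebra A), projective P -> indecomposable P -> uniserial P) ->
  local_idem e -> a * e = a -> b * e = b ->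
  (exists y, a = y * b) \/ (exists y, b = y * a).
Proof.
move=> nak /local_idem_opposite el ae be.
have ea : @GRing.mul (opposite_algebra A) e a = a by rewrite opposite_mulE.
have eb : @GRing.mul (opposite_algebra A) e b = b by rewrite opposite_mulE.
have H := @local_idem_uniserial K (opposite_algebra A) e a b nak el.
have [[y yE]|[y yE]] := H ea eb; [left | right]; exists y; rewrite [LHS]yE.
  by rewrite opposite_mulE.
by rewrite opposite_mulE.
Qed.

Section BoundQuiver.
Variables (K : fieldType) (A : falgType K) (Q : quiver).
Variable f : {lrmorphism path_algebra K Q -> A}.
Hypotheses (fsurj : forall a, exists x, f x = a) (adm : admissible [set x | f x = 0]%classic).
Implicit Types (x y : path_algebra K Q) (v w : vertex Q) (a b : arrow Q).

Let morphZ c x : f (c *: x) = c *: f x.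
Proof. exact: (linearZZ f). Qed.

Lemma ker_arrow_ideal2 x : f x = 0 -> arrow_ideal_pow 2 x.
Proof. by have [_ [m [_ _ ker2]]] := adm; apply: ker2. Qed.

Lemma arrow_ideal_nil x : arrow_ideal_pow 1 x -> exists m, f x ^+ m = 0.
Proof.
have [_ [m [_ kerm _]]] := adm => x1; exists m.
by rewrite -rmorphXn; apply: kerm; apply: arrow_ideal_powX.
Qed.

Definition vertex_idem v : A := f (path_elt K (trivial_path v)).
Definition arrow_image a : A := f (path_elt K (arrow_path a)).

Let e := vertex_idem.
Let g := arrow_image.

Lemma vertex_idemM v w : e v * e w = if v == w then e v else 0.
Proof.
rewrite /e /vertex_idem -rmorphM trivial_mul [path_source _]/=.
by have [->|_] := eqVneq v w; rewrite ?rmorph0.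
Qed.

Lemma vertex_idem_sum : \sum_v e v = 1.
Proof.
have E : (1 : path_algebra K Q) = \sum_v path_elt K (trivial_path v) by [].
by rewrite -(rmorph1 f) E rmorph_sum.
Qed.

Lemma vertex_idem_arrow v a : e v * g a = if v == source a then g a else 0.
Proof.
rewrite /e /vertex_idem -rmorphM trivial_mul [path_source _]/=.
by case: ifP => // _; rewrite rmorph0.
Qed.

Lemma arrow_vertex_idem v a : g a * e v = if target a == v then g a else 0.
Proof.
rewrite /e /vertex_idem -rmorphM mul_trivial [path_target _]/=.
by case: ifP => // _; rewrite rmorph0.
Qed.

Lemma coef_trivial_ker x y v :
  f x = f y -> coef x (trivial_path v) = coef y (trivial_path v).
Proof.
move=> /eqP; rewrite -subr_eq0 -rmorphB /= => /eqP/ker_arrow_ideal2/(_ (trivial_path v)) xy.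
apply/eqP; rewrite -subr_eq0 -pa_coefB; apply/negPn/negP => /xy.
by [].
Qed.

Lemma vertex_idem_neq0 v : e v != 0.
Proof.
apply/eqP => ev; have /(coef_trivial_ker v) : f (path_elt K (trivial_path v)) = f 0.
  by rewrite rmorph0.
by rewrite coef_elt eqxx Defs.coef0 => /eqP; rewrite oner_eq0.
Qed.

Lemma coef_trivial_neq v w : w != v -> coef (path_elt K (trivial_path v)) (trivial_path w) = 0.
Proof. by move=> wv; rewrite coef_elt; case: eqP => // -[wE]; rewrite wE eqxx in wv. Qed.

(** Replacing x by its component from v to v makes it a combination of paths of
    positive length. *)
Lemma corner_nil v x : e v * f x = f x -> f x * e v = f x ->
  coef x (trivial_path v) = 0 -> exists m, f x ^+ m = 0.
Proof.
move=> ex xe x0; pose t := path_elt K (trivial_path v).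
have -> : f x = f (t * x * t) by rewrite !rmorphM [f t * _]ex [_ * f t]xe.
apply: arrow_ideal_nil; apply: arrow_ideal_pow1P => w.
rewrite !coef_mul_trivial; have [->|wv] := eqVneq w v; first by rewrite x0 mulr0 mul0r.
by rewrite coef_trivial_neq // mulr0.
Qed.

(** Let c be the coefficient of the trivial path in x.  If c = 0 then x is
    nilpotent, otherwise e_v - c^-1 x is; a geometric series gives the inverse. *)
Lemma vertex_idem_local v : local_idem (e v).
Proof.
have ee : e v * e v = e v by rewrite vertex_idemM eqxx.
split=> //; first exact: vertex_idem_neq0.
move=> x' ex xe; have [x xE] := fsurj x'; rewrite -{x'}xE in ex xe *.
set c := coef x (trivial_path v); have [c0|c0] := eqVneq c 0.
  have [m xm] := corner_nil ex xe c0.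
  have [||||y hy] := @corner_inverse _ _ (e v) (e v - f x) m => //.
  - by rewrite mulrBr ee ex.
  - by rewrite mulrBl ee xe.
  - by rewrite subKr.
  by exists y; right.
pose z := path_elt K (trivial_path v) - c^-1 *: x.
have zE : f z = e v - c^-1 *: f x by rewrite rmorphB /= morphZ.
have [|||m zm] := @corner_nil v z.
- by rewrite zE mulrBr ee -scalerAr ex.
- by rewrite zE mulrBl ee -scalerAl xe.
- by rewrite pa_coefB coef_elt eqxx Defs.coefZ mulVf ?subrr.
have [||||y [xy yx]] := @corner_inverse _ _ (e v) (c^-1 *: f x) m => //.
- by rewrite -scalerAr ex.
- by rewrite -scalerAl xe.
- by rewrite -zE.
by exists (c^-1 *: y); left; rewrite -scalerAr scalerAl xy -scalerAl scalerAr yx.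
Qed.

(** Relations have no component of length one, and a multiple of the arrow b has
    no component on another arrow. *)
Lemma arrow_image_mull a b z : g a = g b * z -> a = b.
Proof.
have [y <-] := fsurj z; rewrite /g /arrow_image -rmorphM => /eqP.
rewrite -subr_eq0 -rmorphB => /eqP/ker_arrow_ideal2/(_ (arrow_path a)) ker2.
apply: (@coef_arrow_mull K Q a b y); apply/eqP => ab0.
move: ker2; rewrite pa_coefB ab0 subr0 coef_elt eqxx => /(_ (oner_neq0 _)).
by [].
Qed.

Lemma arrow_image_mulr a b z : g a = z * g b -> a = b.
Proof.
have [y <-] := fsurj z; rewrite /g /arrow_image -rmorphM => /eqP.
rewrite -subr_eq0 -rmorphB => /eqP/ker_arrow_ideal2/(_ (arrow_path a)) ker2.
apply: (@coef_arrow_mulr K Q a b y); apply/eqP => ab0.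
move: ker2; rewrite pa_coefB ab0 subr0 coef_elt eqxx => /(_ (oner_neq0 _)).
by [].
Qed.

Section Nakayama.
Hypothesis nak : nakayama A.

(** Two arrows with the same source v generate comparable submodules of the
    uniserial module e_v A, so one is a multiple of the other. *)
Lemma source_inj : injective (@source Q).
Proof.
move=> a b ab; have eg c : e (source c) * g c = g c by rewrite vertex_idem_arrow eqxx.
have ea : e (source b) * g a = g a by rewrite -ab.
have [[y]|[y]] := local_idem_uniserial nak.1 (vertex_idem_local (source b)) ea (eg b).
  exact: arrow_image_mull.
by move/arrow_image_mull.
Qed.

Lemma target_inj : injective (@target Q).
Proof.
move=> a b ab; have eg c : g c * e (target c) = g c by rewrite arrow_vertex_idem eqxx.
have ea : g a * e (target b) = g a by rewrite -ab.
have [[y]|[y]] := local_idem_uniserial_left nak.2 (vertex_idem_local (target b)) ea (eg b).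
  exact: arrow_image_mulr.
by move/arrow_image_mulr.
Qed.

Definition arrow_sum : A := \sum_a g a.
Let s := arrow_sum.

Definition next_vertex v := if [pick a | source a == v] is Some a then target a else v.
Definition prev_vertex v := if [pick a | target a == v] is Some a then source a else v.

Lemma idem_arrow_sum v : e v * s = e v * s * e (next_vertex v).
Proof.
rewrite mulr_sumr mulr_suml; apply: eq_bigr => a _; rewrite vertex_idem_arrow.
case: eqP => [->|_]; last by rewrite mul0r.
rewrite /next_vertex; case: pickP => [b /eqP/source_inj ->|/(_ a)]; last by rewrite eqxx.
by rewrite arrow_vertex_idem eqxx.
Qed.

Lemma arrow_sum_idem v : s * e v = e (prev_vertex v) * s * e v.
Proof.
rewrite mulr_sumr !mulr_suml; apply: eq_bigr => a _; rewrite vertex_idem_arrow.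
rewrite arrow_vertex_idem /prev_vertex; case: eqP => [<-|ne].
  case: pickP => [b /eqP/target_inj ->|/(_ a)]; last by rewrite eqxx.
  by rewrite eqxx arrow_vertex_idem eqxx.
by move/eqP/negPf: ne => ne; case: ifP; rewrite ?mul0r // arrow_vertex_idem ne.
Qed.

Lemma source_arrow_sum a : e (source a) * s = g a.
Proof.
rewrite mulr_sumr (bigD1 a) //= big1 ?addr0 => [|b ba]; rewrite vertex_idem_arrow ?eqxx //.
by case: eqP => // /source_inj ab; rewrite ab eqxx in ba.
Qed.

(** As no two arrows share a source, the source and the length determine a path. *)
Lemma path_image p : f (path_elt K p) = e (path_source p) * s ^+ path_length p.
Proof.
case: p => -[v r] /= wr; rewrite /path_source /path_length /path_arrows /=.
elim: r v wr => [|a r IHr] v wr.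
  by rewrite mulr1 /e /vertex_idem; congr (f (path_elt K _)); apply: val_inj.
have /andP[/eqP av wr'] : (source a == v) && walk (target a) r := wr.
pose p1 := @QPath Q (v, a :: r) wr; pose p2 := @QPath Q (target a, r) wr'.
have -> : path_elt K p1 = path_elt K (arrow_path a) * path_elt K p2.
  rewrite path_elt_mul /path_mul.
  by have /path_compP -> : [/\ path_target (arrow_path a) = path_source p2,
    path_source p1 = path_source (arrow_path a)
    & path_arrows p1 = path_arrows (arrow_path a) ++ path_arrows p2].
rewrite rmorphM /= [f (path_elt K p2)]IHr mulrA [f _ * _]arrow_vertex_idem eqxx -source_arrow_sum av.
by rewrite /= exprS mulrA.
Qed.

Lemma arrow_sum_nil : exists m, s ^+ m = 0.
Proof.
have -> : s = f (\sum_a path_elt K (arrow_path a)) by rewrite rmorph_sum.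
apply: arrow_ideal_nil; apply: arrow_ideal_pow1P => v.
rewrite Defs.coef_sum big1 // => a _; rewrite coef_elt.
by case: (eqVneq (trivial_path v)) => // /(congr1 (@path_length Q)).
Qed.

Lemma vertex_idem_span v (z : A) : exists m (c : nat -> K),
  e v * z = \sum_(i < m) c i *: (e v * s ^+ i).
Proof.
have [m sm] := arrow_sum_nil; exists m; have [x <-] := fsurj z.
pose Sp (y : A) := exists c : nat -> K, y = \sum_(i < m) c i *: (e v * s ^+ i).
suff: Sp (e v * f x) by [].
rewrite [x]path_eltE rmorph_sum mulr_sumr; apply: big_ind.
- by exists (fun=> 0); rewrite big1 // => i _; rewrite scale0r.
- move=> _ _ [c ->] [d ->]; exists (fun i => c i + d i); rewrite -big_split /=.
  by apply: eq_bigr => i _; rewrite scalerDl.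
move=> p _; rewrite /= morphZ -scalerAr path_image mulrA vertex_idemM.
have [_|_] := eqVneq v (path_source p); last first.
  by exists (fun=> 0); rewrite mul0r scaler0 big1 // => i _; rewrite scale0r.
exists (fun i => if i == path_length p then coef x p else 0).
have [pm|mp] := ltnP (path_length p) m.
  rewrite (bigD1 (Ordinal pm)) //= eqxx big1 ?addr0 // => i; rewrite -val_eqE /= => /negPf ->.
  by rewrite scale0r.
rewrite -(subnKC mp) exprD sm mul0r mulr0 scaler0 big1 // => i _.
by rewrite ltn_eqF ?scale0r // (leq_trans (ltn_ord i)) ?leq_addr.
Qed.

Definition quiver_frame : nakayama_frame A (vertex Q) :=
  NakayamaFrame vertex_idemM vertex_idem_sum idem_arrow_sum arrow_sum_idem
    arrow_sum_nil vertex_idem_span.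

End Nakayama.

(** The coefficient of the trivial path at v does not depend on the chosen
    preimage, because relations have no component of length less than two. *)
Lemma vertex_characters : exists chi : vertex Q -> A -> K^o,
  [/\ forall v, linear (chi v), forall v, chi v 1 = 1,
      forall v (a b : A), chi v (a * b) = chi v a * chi v b
    & forall v w, chi v (e w) = (w == v)%:R].
Proof.
have [pre preK] := choice fsurj.
have chiE x v : coef (pre (f x)) (trivial_path v) = coef x (trivial_path v).
  by apply: coef_trivial_ker; rewrite preK.
exists (fun v z => coef (pre z) (trivial_path v)); split=> [v c a b|v|v a b|v w].
- rewrite -{1}(preK a) -{1}(preK b) -morphZ -rmorphD chiE.
  by rewrite Defs.coefD Defs.coefZ.
- by rewrite -(rmorph1 f) chiE pa_coef1.
- by rewrite -{1}(preK a) -{1}(preK b) -rmorphM chiE coef_mul_trivial.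
rewrite chiE; have [->|wv] := eqVneq w v; first by rewrite coef_elt eqxx.
by rewrite coef_trivial_neq // eq_sym.
Qed.

(** The characters above define one-dimensional modules that are pairwise not
    isomorphic, because the idempotents e_w tell them apart. *)
Lemma card_vertex n : number_of_simples A n -> (#|vertex Q| <= n)%N.
Proof.
move=> [S [_ _ simS]].
have [chi [chiL chi1 chiM chie]] := vertex_characters.
have lin1 (v : vertex Q) (a : A) : linear (fun k : K^o => k * chi v a : K^o).
  by move=> c x y; rewrite mulrDl -scalerAl.
have lin2 (v : vertex Q) (k : K^o) : linear (fun z : A => k * chi v z : K^o).
  by move=> c x y; rewrite chiL mulrDr -scalerAr.
have act1 (v : vertex Q) (k : K^o) : k * chi v 1 = k by rewrite chi1 mulr1.
have actM (v : vertex Q) (k : K^o) (a b : A) : k * chi v (a * b) = k * chi v a * chi v b.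
  by rewrite chiM mulrA.
pose T v : rmodule A := @RModule K A K^o (fun k z => k * chi v z)
  (lin1 v) (lin2 v) (act1 v) (actM v).
have dimT v : \dim {:T v} = 1%N by rewrite dimvf.
have simT v : simple_mod (T v).
  split; first by move/(congr1 (fun U : {vspace T v} => \dim U)); rewrite dimT dimv0.
  move=> U _; have := dimvS (subvf U); rewrite dimT leq_eqVlt ltnS leqn0 => /orP[/eqP dU|].
    by right; apply/eqP; rewrite eqEdim subvf dimT dU.
  by rewrite dimv_eq0 => /eqP; left.
have [i iso] := choice (fun v => simS _ (simT v)).
rewrite -(card_ord n); apply: (leq_card i) => v w vw; apply/eqP/negPn/negP => ne.
have [h1 h1h b1] := iso v; have [h2 h2h [h2' _ h2K]] := iso w.
rewrite -vw in h2 h2h h2' h2K.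
have h10 : h1 (1 : K^o) != 0.
  apply/eqP => h10; have := bij_inj b1 (etrans h10 (esym (linear0 h1))).
  by apply/eqP; exact: oner_neq0.
have E : ract (h1 (1 : K^o)) (e v) = h1 (1 : K^o).
  by rewrite -h1h /= mul1r chie eqxx.
move: h10; rewrite -E -(h2K (h1 _)) -h2h /= chie (negPf ne) mulr0 linear0 eqxx.
by [].
Qed.

End BoundQuiver.

(** * The bound on the finitistic dominant dimension *)

Theorem mainTheorem3 (K : fieldType) (A : falgType K) (n : nat)
    (hQI : bound_quiver_algebra A) (hconn : connected_algebra A)
    (hnak : nakayama A) (hnsi : ~ selfinjective A)
    (hn : (2 <= n)%N) (hsimples : number_of_simples A n) :
  (fdomdim A <= ((2 * n - 2)%N%:Z)%:E)%E.
Proof.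
have [Q [f [fsurj adm]]] := hQI.
exact: (fdomdim_bound (quiver_frame fsurj adm hnak) hn (card_vertex fsurj adm hsimples)).
Qed.
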